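(* Let $\mathfrak g$ be a simple complex Lie algebra, $\mathfrak g(\mathbb R)$ a real form of $\mathfrak g$, and let $(\mathfrak g(\mathbb R), W(\mathbb R),\mathfrak d(\mathbb R))$ be a Manin triple over $\mathbb R$. Let $\mathfrak d=\mathfrak d(\mathbb R)\otimes\mathbb C$, identified with $\mathfrak g\otimes A(\mathbb C)$, where $A(\mathbb C)=A_1(\mathbb C)$ or $A(\mathbb C)=A_2(\mathbb C)$, and let $\Gamma=\{1,\sigma\}$ be the Galois group of $\mathbb C/\mathbb R$ acting semilinearly on $\mathfrak d$ with $\mathfrak d^\Gamma=\mathfrak d(\mathbb R)$ and on $\mathfrak g$ with $\mathfrak g^\Gamma=\mathfrak g(\mathbb R)$. Then: 1) There exists a semilinear action of $\Gamma$ on $A(\mathbb C)$ such that $\sigma(x\otimes a)=\sigma(x)\otimes\sigma(a)$ for all $x\otimes a\in\mathfrak d=\mathfrak g\otimes A(\mathbb C)$. 2) The double $\mathfrak d(\mathbb R)$ is isomorphic to $\mathfrak g(\mathbb R)\otimes A(\mathbb R)$, where $A(\mathbb R)$ is one of the algebras $A_1(\mathbb R),A_2(\mathbb R),A_3(\mathbb R)$. 3) Let $Q_{\mathbb R}(\cdot,\cdot)$ be a nondegenerate $\mathrm{ad}$-invariant symmetric bilinear form on $\mathfrak d(\mathbb R)$ such that $\mathfrak g(\mathbb R)$ is an isotropic subspace with respect to $Q_{\mathbb R}$, and let $K_{\mathbb R}(\cdot,\cdot)$ be the Killing form of $\mathfrak g(\mathbb R)$. Then for all $a,b,a',b'\in\mathfrak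 g(\mathbb R)$ $$Q_{\mathbb R}(a+bJ,\,a'+b'J)=\nu\bigl(K_{\mathbb R}(a,b')+K_{\mathbb R}(b,a')\bigr)$$ for some $\nu\in\mathbb R$, where $J$ is the image of $t$ in $A_i(\mathbb R)$ for $i=1,2$, and $J^2=-1$ in $A_3(\mathbb R)=\mathbb C$.
   Context: All Lie algebras are finite-dimensional. A Manin triple over a field $K$ is a triple $(\mathfrak g_1,\mathfrak g_2,\mathfrak d)$ of Lie algebras over $K$, with $\mathfrak g_1,\mathfrak g_2$ subalgebras of $\mathfrak d$, together with a symmetric nondegenerate $\mathrm{ad}$-invariant bilinear form $Q$ on $\mathfrak d$ such that $\mathfrak d=\mathfrak g_1\oplus\mathfrak g_2$ as a vector space and $\mathfrak g_1,\mathfrak g_2$ are maximal isotropic subspaces for $Q$. The algebra $\mathfrak d$ is called the double of $\mathfrak g_1$. Notation: $A_1(\mathbb R)=\mathbb R[t]/(t^2)$, $A_2(\mathbb R)=\mathbb R[t]/(t^2-1/4)$, $A_3(\mathbb R)=\mathbb C$, $A_1(\mathbb C)=\mathbb C[t]/(t^2)$, $A_2(\mathbb C)=\mathbb C[t]/(t^2-1/4)$. For a commutative algebra $A$, $\mathfrak g\otimes A$ has bracket $[x\otimes a,y\otimes b]=[x,y]\otimes ab$; elements $x\otimes 1+y\otimes J$ are written $x+yJ$. Known fact used to identify $\mathfrak d$: if $(\mathfrak g,W,\mathfrak d)$ is a complex Manin triple with $\mathfrak g$ complex simple, then $\mathfrak d\cong\mathfrak g\otimes A(\mathbb C)$ with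 $A(\mathbb C)=A_1(\mathbb C)$ or $A_2(\mathbb C)$, the subalgebra $\mathfrak g\subset\mathfrak d$ corresponding to $\mathfrak g\otimes1$. This is applied to the complexification $(\mathfrak g, W(\mathbb R)\otimes\mathbb C,\mathfrak d(\mathbb R)\otimes\mathbb C)$. Likewise in 2) and 3) the isomorphism identifies $\mathfrak g(\mathbb R)\subset\mathfrak d(\mathbb R)$ with $\mathfrak g(\mathbb R)\otimes 1$. A semilinear action of $\Gamma$ is one in which $\sigma$ acts conjugate-linearly. *)

(* Defs.v *)
From HB Require Import structures.
From mathcomp Require Import all_boot all_order all_algebra.
From mathcomp Require Import complex.

Set Implicit Arguments.
Unset Strict Implicit.
Unset Printing Implicit Defensive.

Import GRing.Theory.
Local Open Scope ring_scope.

(* All Lie algebras are finite-dimensional: the carrier is a vectType. *)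
HB.mixin Record isLieAlgebra (K : fieldType) (L : Type) of Vector K L := {
  lie : L -> L -> L;
  lie_is_linearl : forall y : L, linear (fun x : L => lie x y);
  lie_is_linearr : forall x : L, linear (lie x);
  liexx : forall x : L, lie x x = 0;
  jacobi : forall x y z : L,
    lie x (lie y z) + lie y (lie z x) + lie z (lie x y) = 0
}.

#[short(type="lieAlgType")]
HB.structure Definition LieAlgebra (K : fieldType) :=
  {L of isLieAlgebra K L & Vector K L}.

Section LieAlgebraDefs.
Variables (K : fieldType) (L M : lieAlgType K).

HB.instance Definition _ (x : L) :=
  GRing.isLinear.Build K L L _ (lie x) (lie_is_linearr x).

Definition lie_subalgebra (U : {vspace L}) : Prop :=
  forall x y, x \in U -> y \in U -> lie x y \in U.

Definition lie_ideal (U : {vspace L}) : Prop :=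
  forall x y, y \in U -> lie x y \in U.

Definition simple_lie : Prop :=
  (exists x y : L, lie x y != 0)
  /\ (forall U : {vspace L}, lie_ideal U -> U = 0%VS \/ U = fullv).

Definition lie_hom (f : 'Hom(L, M)) : Prop :=
  forall x y, f (lie x y) = lie (f x) (f y).

Definition lie_iso (f : 'Hom(L, M)) : Prop := lie_hom f /\ bijective f.

Definition ad (x : L) : 'End(L) := linfun (lie x).

Definition killing_form (x y : L) : K :=
  \tr (passmx.mxof (vbasis {:L}) (vbasis {:L}) (ad x \o ad y)%VF).

Definition ad_invariant (Q : L -> L -> K) : Prop :=
  forall x y z, Q (lie x y) z = Q x (lie y z).

Definition isotropic (Q : {symmetric L}) (U : {vspace L}) : Prop :=
  (U <= orthov Q U)%VS.

Definition maximal_isotropic (Q : {symmetric L}) (U : {vspace L}) : Prop :=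
  isotropic Q U
  /\ (forall U' : {vspace L}, isotropic Q U' -> (U <= U')%VS -> U' = U).

Definition manin_triple (g1 g2 : {vspace L}) (Q : {symmetric L}) : Prop :=
  [/\ lie_subalgebra g1 /\ lie_subalgebra g2,
      nondegenerate Q /\ ad_invariant Q,
      (g1 + g2)%VS = fullv /\ (g1 :&: g2)%VS = 0%VS
    & maximal_isotropic Q g1 /\ maximal_isotropic Q g2].

End LieAlgebraDefs.

#[short(type="finComAlgType")]
HB.structure Definition FinComAlgebra (K : fieldType) :=
  {A of GRing.ComAlgebra K A & Vector K A}.

(* V (x) A, through the coordinates in the basis (e_i) = vbasis {:V} of V: the *)
(* function f stands for \sum_i e_i (x) f i.                                  *)
Definition tensor (K : fieldType) (V : vectType K) (A : finComAlgType K) : Type :=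
  {ffun 'I_(\dim {:V}) -> A}.

HB.instance Definition _ (K : fieldType) (V : vectType K)
  (A : finComAlgType K) := Vector.on (tensor V A).

Section Tensor.
Variables (K : fieldType) (A : finComAlgType K).

Definition pure_tensor (V : vectType K) (x : V) (a : A) : tensor V A :=
  [ffun i => coord (vbasis {:V}) i x *: a].

Definition tensor_basis (V : vectType K) (i : 'I_(\dim {:V})) : V :=
  (vbasis {:V})`_i.

Section Linearity.
Variable V : vectType K.

Lemma pure_tensor_linearl (a : A) : linear (fun x : V => pure_tensor x a).
Proof.
move=> k x y; apply/ffunP => i; rewrite !ffunE linearP.
by rewrite scalerDl scalerA.
Qed.

Lemma pure_tensor_linearr (x : V) : linear (pure_tensor x).
Proof.
move=> k a b; apply/ffunP => i; rewrite !ffunE.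
by rewrite scalerDr !scalerA mulrC.
Qed.

HB.instance Definition _ (x : V) :=
  GRing.isLinear.Build K A (tensor V A) _ (pure_tensor x) (pure_tensor_linearr x).

Lemma tensor_expand (f : tensor V A) :
  f = \sum_i pure_tensor (tensor_basis i) (f i).
Proof.
apply/ffunP => j; rewrite sum_ffunE (bigD1 j) //= big1 => [|i neq_ij].
  by rewrite ffunE coord_free ?(basis_free (vbasisP _)) // eqxx scale1r addr0.
rewrite ffunE coord_free ?(basis_free (vbasisP _)) //.
by rewrite (negPf neq_ij) scale0r.
Qed.

Lemma basis_expand (x : V) : x = \sum_i coord (vbasis {:V}) i x *: tensor_basis i.
Proof. exact: coord_vbasis (memvf x). Qed.
End Linearity.

Variable g : lieAlgType K.

(* The bilinear extension of [x (x) a, y (x) b] = [x, y] (x) ab, see          *)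
(* tensor_lie_pure.                                                           *)
Definition tensor_lie (f h : tensor g A) : tensor g A :=
  \sum_i \sum_j
    pure_tensor (lie (tensor_basis i) (tensor_basis j)) (f i * h j).

Lemma tensor_lie_linearl (h : tensor g A) : linear (fun f => tensor_lie f h).
Proof.
move=> k f f'; rewrite /tensor_lie scaler_sumr -big_split; apply: eq_bigr => i _.
rewrite scaler_sumr -big_split; apply: eq_bigr => j _ /=.
by rewrite !ffunE mulrDl -scalerAl linearP.
Qed.

Lemma tensor_lie_linearr (f : tensor g A) : linear (tensor_lie f).
Proof.
move=> k h h'; rewrite /tensor_lie scaler_sumr -big_split; apply: eq_bigr => i _.
rewrite scaler_sumr -big_split; apply: eq_bigr => j _ /=.
by rewrite !ffunE mulrDr -scalerAr linearP.
Qed.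

Lemma lieC (x y : g) : lie x y = - lie y x.
Proof.
have lieDl (u v w : g) : lie (u + v) w = lie u w + lie v w.
  by have := lie_is_linearl w 1 u v; rewrite !scale1r.
apply/eqP; rewrite -addr_eq0; have := liexx (x + y).
by rewrite lieDl !linearD /= !liexx addr0 add0r => ->.
Qed.

Lemma pure_tensor_sumZ (I : finType) (F : I -> K) (e : I -> g) (a : A) :
  pure_tensor (\sum_i F i *: e i) a = \sum_i pure_tensor (e i) (F i *: a).
Proof.
apply/ffunP => j; rewrite sum_ffunE ffunE linear_sum scaler_suml.
by apply: eq_bigr => i _; rewrite linearZ ffunE scalerA mulrC.
Qed.

Lemma tensor_lie_pure (x y : g) (a b : A) :
  tensor_lie (pure_tensor x a) (pure_tensor y b) = pure_tensor (lie x y) (a * b).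
Proof.
have lie_suml (I : finType) (c : I -> K) (e : I -> g) z :
    lie (\sum_i c i *: e i) z = \sum_i c i *: lie (e i) z.
  rewrite lieC linear_sum -sumrN; apply: eq_bigr => i _.
  by rewrite linearZ /= -scalerN -lieC.
rewrite {2}(basis_expand x) lie_suml pure_tensor_sumZ; apply: eq_bigr => i _.
rewrite {2}(basis_expand y) linear_sum /=.
under [in RHS]eq_bigr => j _ do rewrite linearZ /=.
rewrite pure_tensor_sumZ; apply: eq_bigr => j _.
by rewrite !ffunE -scalerAl -scalerAr !scalerA mulrC.
Qed.

Lemma tensor_lie_alt (f : tensor g A) : tensor_lie f f = 0.
Proof.
pose F i j := pure_tensor (lie (tensor_basis i) (tensor_basis j)) (f i * f j).
have FN i j : F i j = - F j i.
  rewrite /F lieC mulrC; apply/ffunP => k.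
  by rewrite !ffunE linearN scaleNr.
have F0 i : F i i = 0.
  by rewrite /F liexx; apply/ffunP => k; rewrite !ffunE linear0 scale0r.
have split i : \sum_j F i j
    = \sum_(j < _ | (j < i)%N) F i j + \sum_(j < _ | (i < j)%N) F i j.
  rewrite (bigID (fun j : 'I__ => (j < i)%N)) /=; congr (_ + _).
  rewrite (bigD1 i) ?ltnn //= F0 add0r; apply: eq_bigl => j.
  by rewrite -leqNgt andbC (ltn_neqAle i) eq_sym.
rewrite /tensor_lie (eq_bigr _ (fun i _ => split i)) big_split /=.
rewrite (exchange_big_dep predT) //= -big_split big1 // => i _ /=.
apply/eqP; rewrite addr_eq0 -sumrN; apply/eqP.
by apply: eq_bigr => j _; rewrite FN.
Qed.

Lemma tensor_jacobi (f h k : tensor g A) :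
  tensor_lie f (tensor_lie h k) + tensor_lie h (tensor_lie k f)
    + tensor_lie k (tensor_lie f h) = 0.
Proof.
have sumr (I : finType) (u : tensor g A) (v : I -> tensor g A) :
    tensor_lie u (\sum_i v i) = \sum_i tensor_lie u (v i).
  apply: (big_morph (tensor_lie u) (id1 := 0) (op1 := +%R)) => [s t|].
    by have := tensor_lie_linearr u 1 s t; rewrite !scale1r.
  by have := tensor_lie_linearr u (-1) 0 0; rewrite !scaleN1r oppr0 addr0 addNr.
have suml (I : finType) (u : tensor g A) (v : I -> tensor g A) :
    tensor_lie (\sum_i v i) u = \sum_i tensor_lie (v i) u.
  apply: (big_morph (tensor_lie^~ u) (id1 := 0) (op1 := +%R)) => [s t|].
    by have := tensor_lie_linearl u 1 s t; rewrite !scale1r.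
  by have := tensor_lie_linearl u (-1) 0 0; rewrite !scaleN1r oppr0 addr0 addNr.
pose e := @tensor_basis g.
have trip (u v w : tensor g A) : tensor_lie u (tensor_lie v w) =
    \sum_i \sum_j \sum_l
      pure_tensor (lie (e i) (lie (e j) (e l))) (u i * (v j * w l)).
  rewrite {1}(tensor_expand u) suml; apply: eq_bigr => i _.
  rewrite {1}(tensor_expand v) suml sumr; apply: eq_bigr => j _.
  rewrite {1}(tensor_expand w) !sumr; apply: eq_bigr => l _.
  by rewrite !tensor_lie_pure.
rewrite !trip.
have -> : \sum_i \sum_j \sum_l
      pure_tensor (lie (e i) (lie (e j) (e l))) (h i * (k j * f l))
  = \sum_i \sum_j \sum_l
      pure_tensor (lie (e j) (lie (e l) (e i))) (h j * (k l * f i)).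
  rewrite [RHS]exchange_big /=; apply: eq_bigr => i _.
  by rewrite [RHS]exchange_big.
have -> : \sum_i \sum_j \sum_l
      pure_tensor (lie (e i) (lie (e j) (e l))) (k i * (f j * h l))
  = \sum_i \sum_j \sum_l
      pure_tensor (lie (e l) (lie (e i) (e j))) (k l * (f i * h j)).
  rewrite exchange_big /=; apply: eq_bigr => i _.
  by rewrite exchange_big.
rewrite -!big_split big1 // => i _; rewrite -!big_split big1 // => j _.
rewrite -!big_split big1 //= => l _.
have -> : h j * (k l * f i) = f i * (h j * k l) by rewrite mulrA mulrC.
have -> : k l * (f i * h j) = f i * (h j * k l) by rewrite mulrC mulrA.
have D x y a : pure_tensor (x : g) a + pure_tensor y a = pure_tensor (x + y) a.
  by have := pure_tensor_linearl a 1 x y; rewrite !scale1r => ->.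
rewrite !D jacobi.
by apply/ffunP => m; rewrite !ffunE linear0 scale0r.
Qed.

HB.instance Definition _ := isLieAlgebra.Build K (tensor g A)
  tensor_lie_linearl tensor_lie_linearr tensor_lie_alt tensor_jacobi.

End Tensor.

Notation "x \ox a" := (pure_tensor x a)
  (at level 40, left associativity, format "x  \ox  a") : ring_scope.

(* {poly %/ p} is K[t]/(p) for p monic of positive degree, and 'qX is the     *)
(* class of t.                                                                *)
Definition A1_poly (K : fieldType) : {poly K} := 'X^2.
Definition A2_poly (K : fieldType) : {poly K} := 'X^2 - (4%:R^-1)%:P.

HB.instance Definition _ (K : fieldType) (p : {poly K}) :=
  Vector.on {poly %/ p}.

Definition A1 (K : fieldType) : finComAlgType K := {poly %/ A1_poly K}.
Definition A2 (K : fieldType) : finComAlgType K := {poly %/ A2_poly K}.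

(* Rcomplex R is R[i] viewed as an algebra over R. *)
Section RcomplexAlgebra.
Variable R : rcfType.

Lemma Rcomplex_vect_axiom : Vector.axiom 2 (Rcomplex R).
Proof.
pose f (z : Rcomplex R) : 'rV[R]_2 :=
  \row_i if i == 0 then complex.Re z else complex.Im z.
exists f; last first.
  exists (fun r : 'rV_2 => (r 0 0 +i* r 0 1)%C : Rcomplex R).
    by case=> a b; rewrite !mxE.
  by move=> r; apply/rowP => -[[|[|//]] i_lt]; rewrite !mxE; congr (r 0 _);
    apply: val_inj.
by move=> k [a b] [c d]; apply/rowP => i; rewrite !mxE; case: (i == 0).
Qed.

HB.instance Definition _ :=
  GRing.Lalgebra_isComAlgebra.Build R (Rcomplex R).
HB.instance Definition _ :=
  Lmodule_hasFinDim.Build R (Rcomplex R) Rcomplex_vect_axiom.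

End RcomplexAlgebra.

Inductive real_index := One | Two | Three.

Definition A_real (R : rcfType) (n : real_index) : finComAlgType R :=
  match n with
  | One => A1 R
  | Two => A2 R
  | Three => Rcomplex R
  end.

Definition J_real (R : rcfType) (n : real_index) : A_real R n :=
  match n return A_real R n with
  | One => 'qX : {poly %/ A1_poly R}
  | Two => 'qX : {poly %/ A2_poly R}
  | Three => ('i)%C
  end.

(* V (x)_R C, with C acting through the second factor. *)
Definition complexification (R : rcfType) (V : vectType R) : Type :=
  tensor V (Rcomplex R).

HB.instance Definition _ (R : rcfType) (V : vectType R) :=
  Vector.copy (complexification V) {ffun 'I_(\dim {:V}) -> R[i]^o}.

Section ComplexificationLie.
Variables (R : rcfType) (g : lieAlgType R).

Definition complexification_lie : complexification g -> complexification g ->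
  complexification g := @tensor_lie R (Rcomplex R) g.

Lemma pure_tensor_mulc (V : vectType R) (c : R[i]) (x : V) (a : Rcomplex R) :
  c *: (x \ox a : complexification V) = x \ox (c * a : Rcomplex R).
Proof.
apply/ffunP => i; rewrite !ffunE.
exact/esym/(@scalerAr R (Rcomplex R) _ c a).
Qed.

Lemma complexification_lie_linearl (h : complexification g) :
  linear (fun f => complexification_lie f h).
Proof.
move=> c f f'; rewrite /complexification_lie /tensor_lie scaler_sumr.
rewrite -big_split; apply: eq_bigr => i _.
rewrite scaler_sumr -big_split; apply: eq_bigr => j _.
by rewrite !ffunE mulrDl linearD /= pure_tensor_mulc mulrA.
Qed.

Lemma complexification_lie_linearr (f : complexification g) :
  linear (complexification_lie f).
Proof.
move=> c h h'; rewrite /complexification_lie /tensor_lie scaler_sumr.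
rewrite -big_split; apply: eq_bigr => i _.
rewrite scaler_sumr -big_split; apply: eq_bigr => j _.
by rewrite !ffunE mulrDr linearD /= pure_tensor_mulc mulrCA.
Qed.

HB.instance Definition _ := isLieAlgebra.Build R[i] (complexification g)
  complexification_lie_linearl complexification_lie_linearr
  (@tensor_lie_alt R (Rcomplex R) g) (@tensor_jacobi R (Rcomplex R) g).

End ComplexificationLie.

Definition to_complexification (R : rcfType) (V : vectType R) (x : V) :
  complexification V := x \ox (1 : Rcomplex R).

(* The action of Gal(C/R) = {1, s} on V is given by the action of s. *)
Definition semilinear_action (R : rcfType) (V : lmodType R[i]) (s : V -> V) :
    Prop :=
  (forall (c : R[i]) (u v : V), s (c *: u + v) = conjc c *: s u + s v)
  /\ involutive s.

(* Main.v *)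
From HB Require Import structures.
Require Import Defs.
From mathcomp Require Import all_boot all_order all_algebra.
From mathcomp Require Import complex reals ring.

(* 1) By Schur's lemma every linear map [g -> g (x) A] commuting with [ad g] is
   [x |-> x (x) b] for some [b] in [A]. For fixed [a], the map
   [x |-> sigma (sigma x (x) a)] commutes with [ad g]; the resulting [b] is
   [sigma a].
   2) [A] has a [sigma]-fixed generator [K] with [K ^ 2] one of [0], [1/4], [-1],
   and [d(R)], being the fixed part of [g (x) A], is [g(R) + g(R) K].
   3) [Q] vanishes on [g(R) J x g(R) J] since [g(R)] is perfect and isotropic, so
   [Q] is governed by the nondegenerate invariant form [B (x, y) = Q (x, y J)].
   Writing the Killing form as [B (T x, y)], [T] commutes with [ad g(R)], hence
   is a scalar, and it is nonzero by Cartan's criterion. For the latter, if the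
   Killing form vanishes, let [D] act by [conj l] on the generalized eigenspace of
   [ad x] for [l]: [D] is a derivation, so [y |-> tr (ad y D)] kills brackets,
   hence is zero, and [0 = tr (ad x D)] is the sum of the [|l| ^ 2]. Thus [ad x] is
   nilpotent for all [x], contradicting simplicity by Engel's theorem. *)

Set Implicit Arguments.
Unset Strict Implicit.
Unset Printing Implicit Defensive.

Import Order.TTheory GRing.Theory Num.Theory.
Import passmx.
Local Open Scope ring_scope.

(** * Simple Lie algebras and Engel's theorem *)

Section LieBasics.
Variables (K : fieldType) (L : lieAlgType K).
Implicit Types x y z u v w : L.

Lemma lieDl x y z : lie (x + y) z = lie x z + lie y z.
Proof. by rewrite !(lieC _ z) linearD opprD. Qed.

Lemma lieZl (a : K) x z : lie (a *: x) z = a *: lie x z.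
Proof. by rewrite !(lieC _ z) linearZ scalerN. Qed.

Lemma lieNl x z : lie (- x) z = - lie x z.
Proof. by rewrite !(lieC _ z) linearN. Qed.

Lemma lieNr x z : lie x (- z) = - lie x z.
Proof. exact: linearN. Qed.

Lemma lie_leibniz x y z : lie x (lie y z) = lie (lie x y) z + lie y (lie x z).
Proof.
have /eqP := jacobi x y z; rewrite -addrA addr_eq0 => /eqP ->.
by rewrite opprD (lieC z x) linearN opprK (lieC z) opprK addrC.
Qed.

Lemma lie_bracketl x y z : lie (lie x y) z = lie x (lie y z) - lie y (lie x z).
Proof. by rewrite (lie_leibniz x y z) addrK. Qed.

Hypothesis simpleL : simple_lie L.

(** The kernel contains every bracket, so it is an ideal, and it is nonzero because some bracket is.
    Maps are passed as plain functions with a proof of [linear] since they are built on the spot,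
    for instance by [complexify]. *)
Lemma simple_vanish (V : vectType K) (f : L -> V) :
  linear f -> (forall x y, f (lie x y) = 0) -> forall x, f x = 0.
Proof.
move=> f_lin l0; pose fL := GRing.isLinear.Build K L V *:%R f f_lin.
pose l : {linear L -> V} := HB.pack f fL.
rewrite -[f]/(l : L -> V) in l0 *.
have memk x : (x \in lker (linfun l)) = (l x == 0).
  by rewrite memv_ker lfunE.
case: simpleL => -[x0 [y0 n0]] /(_ (lker (linfun l))) [x y _||full x].
- by rewrite memk l0.
- move=> k0; have := memk (lie x0 y0); rewrite k0 memv0 l0 eqxx => n1.
  by rewrite n1 in n0.
by apply/eqP; rewrite -memk full memvf.
Qed.

(** A central element spans an ideal; if this line were everything, all brackets would vanish. *)
Lemma simple_center z : (forall x, lie x z = 0) -> z = 0.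
Proof.
move=> zC; case: simpleL => -[x0 [y0 n0]] /(_ <[z]>%VS) [x y|/eqP|full].
- by case/vlineP => k ->; rewrite linearZ /= zC scaler0 mem0v.
- by rewrite -dimv_eq0 dim_vline; case: (z =P 0).
have /vlineP [k ky] : y0 \in <[z]>%VS by rewrite full memvf.
by rewrite ky linearZ /= zC scaler0 eqxx in n0.
Qed.

Lemma simple_dim_gt0 : (0 < \dim {:L})%N.
Proof.
case: simpleL => -[x0 [y0 n0]] _; rewrite lt0n dimv_eq0.
by apply: contraNneq n0 => d0; rewrite -memv0 -d0 memvf.
Qed.

End LieBasics.

(** An eigenspace of [f0] is an ideal, and a nonzero eigenvector exists because the dimension is
    positive and the field is closed. *)
Lemma simple_schur (C : closedFieldType) (L : lieAlgType C) (f0 : L -> L) :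
  simple_lie L -> linear f0 -> (forall x y, f0 (lie x y) = lie x (f0 y)) ->
  exists c : C, forall x, f0 x = c *: x.
Proof.
move=> simpleL f_lin Fad; pose fL := GRing.isLinear.Build C L L *:%R f0 f_lin.
pose F : {linear L -> L} := HB.pack f0 fL.
rewrite -[f0]/(F : L -> L) in Fad *.
pose e := vbasis {:L}; have eP : basis_of {:L} e := vbasisP _.
pose f : 'End(L) := linfun F.
have d0 := simple_dim_gt0 simpleL.
have [c] : exists c, root (char_poly (mxof e e f)) c.
  by apply/closed_rootP; rewrite size_char_poly eqSS -lt0n.
rewrite -eigenvalue_root_char => /eigenvalueP [v vE v0]; exists c.
pose G := f - c *: \1%VF.
have GE x : G x = F x - c *: x by rewrite add_lfunE opp_lfunE scale_lfunE id_lfunE lfunE.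
case: (simpleL) => _ /(_ (lker G)) [x y|k0|full x].
- rewrite !memv_ker !GE Fad => /eqP yk.
  by rewrite -linearZ -linearB /= yk linear0.
- have : vecof e v \in lker G.
    rewrite memv_ker GE -(lfunE F) (hom_vecof e eP) vE.
    by rewrite linearZ subrr.
  by rewrite k0 memv0 vecof_eq0 // (negPf v0).
by apply/eqP; rewrite -subr_eq0 -GE -memv_ker full memvf.
Qed.

Section Engel.
Variables (K : fieldType) (L : lieAlgType K).
Implicit Types (x y z v w : L) (U V : {vspace L}).

(* Engel's conclusion for [k] acting on every quotient [V / V']; this generality
   is what lets the induction on [\dim k] go through. *)
Let engel_prop (k : {vspace L}) := forall V' V, (V' <= V)%VS -> V' != V ->
  (forall x y, x \in k -> y \in V' -> lie x y \in V') ->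
  (forall x y, x \in k -> y \in V -> lie x y \in V) ->
  exists2 v, v \in V & v \notin V' /\ (forall x, x \in k -> lie x v \in V').

Lemma subv_neq_ex V' V : (V' <= V)%VS -> V' != V ->
  exists2 v, v \in V & v \notin V'.
Proof.
move=> sV neq; have: ~~ (V <= V')%VS.
  by apply: contra neq => s2; rewrite eqEsubv sV s2.
by case/subvPn => v; exists v.
Qed.

Hypothesis nilL : forall x, exists N, forall v, iter N (lie x) v = 0.

(** The property for [k] acting on [L / k] yields [v] outside [k] with [[k, v]] inside [k], so
    adding the line of [v] gives a subalgebra. Vectors of [V] sent into [V'] by [k] are stable under
    [ad v], whose nilpotency produces one that [v] sends into [V'] as well. *)
Lemma engel_step (k : {vspace L}) : lie_subalgebra k -> engel_prop k ->
  k != fullv -> exists k', [/\ lie_subalgebra k', engel_prop k' &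
    \dim k' = (\dim k).+1].
Proof.
move=> ksub kE kT.
have [v _ [vk kv]] := kE k fullv (subvf _) kT ksub (fun _ _ _ _ => memvf _).
have addP x : x \in (k + <[v]>)%VS -> exists2 y, y \in k & exists a, x = y + a *: v.
  by case/memv_addP => y yk [w /vlineP [a ->] ->]; exists y => //; exists a.
exists (k + <[v]>)%VS; split.
- move=> _ _ /addP [x xk [a ->]] /addP [y yk [b ->]].
  apply: (subvP (addvSl _ _)).
  rewrite lieDl !linearD !linearZ /= !lieZl liexx !scaler0 addr0.
  by rewrite (lieC v) scalerN !(memvD, memvN, memvZ, kv, ksub).
- move=> V' V sV neq stV' stV.
  have sk x : x \in k -> x \in (k + <[v]>)%VS by apply/subvP/addvSl.
  have vk' : v \in (k + <[v]>)%VS by apply: (subvP (addvSr _ _)); exact: memv_line.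
  have [w wV [wV' kw]] := kE V' V sV neq (fun x y xk => stV' x y (sk x xk))
    (fun x y xk => stV x y (sk x xk)).
  have [N vN] := nilL v.
  have : iter N (lie v) w \in V' by rewrite vN mem0v.
  (* Replace [w] by [[v, w]] until the next bracket falls into [V']; the nilpotency exponent bounds
     the number of replacements. *)
  elim: N {vN} w wV wV' kw => [|N IH] w wV wV' kw; first by rewrite /= (negPf wV').
  have [vw|vw] := boolP (lie v w \in V').
    move=> _; exists w => //; split=> // _ /addP [x xk [a ->]].
    rewrite lieDl lieZl. by apply: memvD; [exact: kw | exact: memvZ].
  rewrite iterSr; apply: IH => //; first exact: stV.
  (* Both Leibniz terms lie in [V']: [[x, v]] is in [k], and [[x, w]] is in [V'], which [v]
     preserves. *)
  move=> x xk; rewrite lie_leibniz memvD //; first by rewrite kw ?kv.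
  exact: stV' (kw _ xk).
rewrite dimv_disjoint_sum; last first.
  apply/eqP; rewrite -subv0; apply/subvP => x; rewrite memv_cap => /andP [xk].
  case/vlineP => a xa; rewrite xa memv0 scaler_eq0.
  have [//|a0] := eqVneq a 0; case/negP: vk.
  by rewrite -(scalerK a0 v) memvZ // -xa.
rewrite dim_vline; case: eqP vk => [->|]; last by rewrite addn1.
by rewrite mem0v.
Qed.

(** Climb from the zero subalgebra to [L] one dimension at a time, then use the property with
    [V' = 0] and [V = L]. *)
Theorem engel : (0 < \dim {:L})%N -> exists2 z, z != 0 & forall x, lie x z = 0.
Proof.
move=> d0.
have chain m : (m <= \dim {:L})%N -> exists k : {vspace L},
    [/\ lie_subalgebra k, engel_prop k & \dim k = m].
  elim: m => [_|m IH mL].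
    exists 0%VS; split; last by rewrite dimv0.
      by move=> x y; rewrite !memv0 => /eqP -> /eqP ->; rewrite linear0.
    move=> V' V sV neq _ _; have [v vV vV'] := subv_neq_ex sV neq.
    exists v => //; split=> // x; rewrite memv0 => /eqP ->.
    by rewrite lieC linear0 oppr0 mem0v.
  have [k [ksub kE dk]] := IH (ltnW mL).
  have kT : k != fullv by apply: contraTneq mL => kT; rewrite -dk kT ltnn.
  by have [k' [? ? dk']] := engel_step ksub kE kT; exists k'; rewrite dk' dk.
have [k [_ kE dk]] := chain _ (leqnn _).
have kT : k = fullv by apply/eqP; rewrite eqEdim subvf dk leqnn.
have [||||z _ [z0 zC]] := kE 0%VS fullv; rewrite ?sub0v //.
- by apply: contraTneq d0 => <-; rewrite dimv0.
- by move=> x y _; rewrite memv0 => /eqP ->; rewrite linear0 mem0v.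
- by move=> *; rewrite memvf.
exists z; first by rewrite memv0 in z0.
by move=> x; apply/eqP; rewrite -memv0 zC // kT memvf.
Qed.

End Engel.

(** * Nilpotency from a vanishing trace form *)

Lemma coprimep_XsubC_exp (F : fieldType) (a b : F) M N : a != b ->
  coprimep (('X - a%:P) ^+ M) (('X - b%:P) ^+ N).
Proof.
move=> ab; apply: coprimep_expl; apply: coprimep_expr.
by rewrite coprimep_XsubC root_XsubC eq_sym.
Qed.

(** Chinese remaindering, one point at a time. *)
Lemma poly_interpolate_mod (F : fieldType) (rs : seq F) (f : F -> F) N : uniq rs ->
  exists p : {poly F}, {in rs, forall a, ('X - a%:P) ^+ N %| p - (f a)%:P}.
Proof.
elim: rs => [|a rs IH] /=; first by exists 0.
case/andP => ars /IH [p pP]; pose M := \prod_(b <- rs) ('X - b%:P) ^+ N.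
have : coprimep M (('X - a%:P) ^+ N).
  rewrite /M big_seq; elim/big_ind: _ => [|q q' cq cq'|b bs].
  - exact: coprime1p.
  - by rewrite coprimepMl cq.
  - by apply: coprimep_XsubC_exp; apply: contraNneq ars => <-.
case/Bezout_eq1_coprimepP => -[u v] /= uv.
(* [u * M] is [0] modulo the powers at the old points and [1] modulo the power at [a], so the
   correction changes only the residue at [a]. *)
exists (p + ((f a)%:P - p) * (u * M)) => b; rewrite inE; case/predU1P => [->|bs].
  have -> : p + ((f a)%:P - p) * (u * M) - (f a)%:P
      = (p - (f a)%:P) * v * ('X - a%:P) ^+ N.
    by rewrite -[u * M](addrK (v * ('X - a%:P) ^+ N)) uv; ring.
  by rewrite dvdp_mulIr.
rewrite addrAC dvdp_add ?pP // dvdp_mull // dvdp_mull // /M (big_rem b) //=.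
exact: dvdp_mulIl.
Qed.

Section Triangular.
Variables (F : fieldType) (n : nat).
Implicit Types T U : 'M[F]_n.+1.

Lemma mulmx_trig T U : is_trig_mx T -> is_trig_mx U ->
  is_trig_mx (T *m U) /\ forall i, (T *m U) i i = T i i * U i i.
Proof.
move=> /is_trig_mxP Tt /is_trig_mxP Ut; split.
  apply/is_trig_mxP => i j ij; rewrite mxE big1 // => k _.
  have [ik|ki] := ltnP i k; first by rewrite Tt // mul0r.
  by rewrite Ut ?mulr0 // (leq_ltn_trans ki).
move=> i; rewrite mxE (bigD1 i) //= big1 ?addr0 // => k ki.
have [ik|ik|ik] := ltngtP i k; first by rewrite Tt // mul0r.
  by rewrite Ut ?mulr0.
by case/eqP: ki; apply: val_inj.
Qed.

Lemma horner_mx_trig T p : is_trig_mx T ->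
  is_trig_mx (horner_mx T p) /\ forall i, horner_mx T p i i = p.[T i i].
Proof.
move=> Tt; elim/poly_ind: p => [|p c [IHt IHd]].
  rewrite rmorph0 mx0_is_trig; split=> // i; by rewrite mxE horner0.
rewrite rmorphD rmorphM /= horner_mx_X horner_mx_C.
have [Mt Md] := mulmx_trig IHt Tt; split.
  move/is_trig_mxP: Mt => Mt; apply/is_trig_mxP => i j ij.
  by rewrite mxE Mt // mxE -val_eqE ltn_eqF // addr0.
by move=> i; rewrite mxE Md IHd mxE eqxx hornerMXaddC.
Qed.

End Triangular.

(** [S (a + b)] obeys a Leibniz rule with [S a] on the left factor and [S b] on the right, so each
    application uses up one unit of [M] or of [N]. *)
Lemma generalized_eigenvector_bracket (K : fieldType) (L : lieAlgType K) (x : L)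
    (S := fun a (v : L) => lie x v - a *: v) (a b : K) M N u v :
  iter M (S a) u = 0 -> iter N (S b) v = 0 ->
  iter (M + N) (S (a + b)) (lie u v) = 0.
Proof.
have SD c w1 w2 : S c (w1 + w2) = S c w1 + S c w2.
  by rewrite /S linearD scalerDr opprD addrACA.
have iterD c k w1 w2 : iter k (S c) (w1 + w2) = iter k (S c) w1 + iter k (S c) w2.
  by elim: k => //= k ->; rewrite SD.
have S0 c k : iter k (S c) 0 = 0.
  by elim: k => //= k ->; rewrite /S linear0 scaler0 subr0.
have Suv w1 w2 : S (a + b) (lie w1 w2) = lie (S a w1) w2 + lie w1 (S b w2).
  by rewrite /S lie_leibniz -!scaleNr lieDl lieZl linearD linearZ opprD scalerDl addrACA.
elim: M N u v => [|M IHM] N u v.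
  by move=> /= -> _; rewrite lieC linear0 oppr0 S0.
elim: N v => [|N IHN] v uM vN; first by rewrite /= in vN; rewrite vN linear0 S0.
rewrite addSn iterSr Suv iterD IHM //; last by rewrite -iterSr.
by rewrite add0r addnS -addSn IHN // -iterSr.
Qed.

(** After a unitary triangularization the trace is the sum of the squared moduli of the eigenvalues,
    so all of them vanish and Cayley-Hamilton applies. *)
Lemma trace_conj_nilpotent (C : numClosedFieldType) n (M : 'M[C]_n.+1) p :
  (forall b, root (char_poly M) b -> p.[b] = b^*) ->
  \tr (M *m horner_mx M p) = 0 -> M ^+ n.+1 = 0.
Proof.
move=> pP tr0; have [P Pu Tt] := @Schur C n.+1 M isT.
have {}Pu := unitarymx_unit Pu.
rewrite /similar_to conjumx // in Tt; set T := P *m M *m invmx P in Tt.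
have hT q : horner_mx T q = P *m horner_mx M q *m invmx P by rewrite horner_mx_uconj.
have rootT i : root (char_poly M) (T i i).
  rewrite -root_mxminpoly -(mxminpoly_uconj _ Pu) conjumx // root_mxminpoly.
  rewrite char_poly_trig // -(big_map _ predT (fun x => 'X - x%:P)).
  by rewrite root_prod_XsubC; apply/mapP; exists i; rewrite ?mem_index_enum.
have T0 i : T i i = 0.
  have : \tr (horner_mx T ('X * p)) = 0.
    by rewrite hT mxtrace_mulC mulKmx // rmorphM /= horner_mx_X.
  move/eqP; rewrite /mxtrace.
  rewrite (eq_bigr (fun i => T i i * (T i i)^*)); last first.
    move=> k _; have [_ ->] := horner_mx_trig ('X * p) Tt.
    by rewrite hornerM hornerX pP.
  rewrite psumr_eq0 => [/allP /(_ i (mem_index_enum _)) /=|k _]; last exact: mul_conjC_ge0.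
  by rewrite mul_conjC_eq0 => /eqP.
have := Cayley_Hamilton T.
rewrite char_poly_trig // (eq_bigr (fun=> 'X)) => [|i _]; last by rewrite T0 subr0.
rewrite prodr_const card_ord hT rmorphXn /= horner_mx_X.
move/(congr1 (fun N => invmx P *m N *m P)).
by rewrite mulmx0 mul0mx !mulmxA mulVmx // mul1mx mulmxKV.
Qed.

Section CartanCriterion.
Variables (C : numClosedFieldType) (n : nat) (L : lieAlgType C).
(** The coordinates are left abstract so that a complexification can use those along a real basis,
    where [ad] of a real vector has a real matrix. Matrices act on row vectors, which reverses
    products. *)
Variables (r : {linear L -> 'rV[C]_n.+1}) (r' : 'rV[C]_n.+1 -> L).
Hypotheses (rK : cancel r r') (r'K : cancel r' r).
Variable A : L -> 'M[C]_n.+1.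
Hypothesis rA : forall x v, r (lie x v) = r v *m A x.

Let mx_ext (M N : 'M_n.+1) : (forall v, r v *m M = r v *m N) -> M = N.
Proof.
by move=> MN; apply/row_matrixP => i; rewrite !rowE -(r'K (delta_mx 0 i)).
Qed.

Let r'D u v : r' (u + v) = r' u + r' v.
Proof. by apply: (can_inj rK); rewrite linearD !r'K. Qed.

Lemma shifted_ad_iter x b k v :
  r (iter k (fun v => lie x v - b *: v) v) = r v *m horner_mx (A x) (('X - b%:P) ^+ k).
Proof.
elim: k => [|k IH]; first by rewrite expr0 rmorph1 mulmx1.
rewrite iterS linearB linearZ /= rA IH exprSr rmorphM rmorphB /= horner_mx_X horner_mx_C.
by rewrite -mulmxE mulmxBr mulmxBr mul_mx_scalar mulmxA scalemxAr.
Qed.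

(** [L] is the sum of the generalized eigenspaces of [ad x], and the exponent [n.+1] suffices as no
    multiplicity exceeds the dimension. Hence an additive property need only be checked on these
    spaces. *)
Lemma generalized_eigenvector_ind x (Q : L -> Prop) : Q 0 ->
    (forall u v, Q u -> Q v -> Q (u + v)) ->
    (forall b v, iter n.+1 (fun v => lie x v - b *: v) v = 0 -> Q v) ->
  forall v, Q v.
Proof.
move=> Q0 QD Qb v.
have [rs chi] := closed_field_poly_normal (char_poly (A x)).
have sz : size rs = n.+1.
  have := size_char_poly (A x); rewrite chi size_scale ?size_prod_XsubC => [[]//|].
  by rewrite (monicP (char_poly_monic _)) oner_eq0.
rewrite (monicP (char_poly_monic _)) scale1r in chi.
(* One factor per distinct root makes the factors coprime; the uniform exponent [n.+1] keeps the
   characteristic polynomial a divisor of their product. *)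
pose ds := undup rs; pose q i := ('X - (ds`_i)%:P) ^+ n.+1.
have chi_dvd : char_poly (A x) %| \prod_(i < size ds) q i.
  rewrite chi -(big_mkord predT q).
  rewrite -[\prod_(0 <= i < _) _](big_nth 0 predT (fun b => ('X - b%:P) ^+ n.+1)).
  rewrite -prodr_undup_exp_count; elim/big_ind2: _ => // [???? d1 d2|b _].
    exact: dvdp_mul.
  by rewrite dvdp_exp2l // -sz count_size.
have cop : {in predT &, forall i k : 'I_(size ds), k != i -> coprimep (q i) (q k)}.
  move=> i k _ _ ki.
  by apply: coprimep_XsubC_exp; rewrite nth_uniq ?undup_uniq // eq_sym.
have qE := kermxpoly_prod (A x) cop.
have /sub_sumsmxP [w vw] : (r v <= \sum_(i < size ds) kermxpoly (A x) (q i))%MS.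
  rewrite -qE; apply/sub_kermxP.
  have /dvdpP [t ->] := chi_dvd.
  by rewrite rmorphM /= Cayley_Hamilton mulr0 mulmx0.
have -> : v = \sum_(i < size ds) r' (w i *m kermxpoly (A x) (q i)).
  apply: (can_inj rK); rewrite linear_sum vw; apply: eq_bigr => i _.
  by rewrite r'K.
elim/big_ind: _ => // i _; apply: (Qb ds`_i); apply: (can_inj rK).
rewrite linear0 shifted_ad_iter r'K; apply/sub_kermxP.
exact: submxMl.
Qed.

Lemma ad_nilpotent_pos_dim : (forall u v, \tr (A u *m A v) = 0) ->
    (forall l : L -> C^o, linear l -> (forall u v : L, l (lie u v) = 0) ->
      forall x, l x = 0) ->
  forall x v : L, iter n.+1 (lie x) v = 0.
Proof.
move=> tr0 perfect x.
have [rs chi] := closed_field_poly_normal (char_poly (A x)).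
rewrite (monicP (char_poly_monic _)) scale1r in chi.
have chi_root b : root (char_poly (A x)) b = (b \in undup rs).
  by rewrite chi root_prod_XsubC mem_undup.
(* The bracket of two vectors killed at exponent [n.+1] is killed at twice that exponent, and [D]
   must act by a scalar on it too. *)
pose N := (n.+1 + n.+1)%N.
have [p pP] := poly_interpolate_mod (fun b => b^*) N (undup_uniq rs).
pose D := horner_mx (A x) p; pose d v := r' (r v *m D).
have dD u v : d (u + v) = d u + d v by rewrite /d linearD mulmxDl r'D.
have d0 : d 0 = 0 by apply: (addrI (d 0)); rewrite -dD !addr0.
have dE b v : iter N (fun v => lie x v - b *: v) v = 0 -> d v = b^* *: v.
  move/(congr1 r); rewrite linear0 shifted_ad_iter => vb.
  apply: (can_inj rK); rewrite r'K linearZ /=.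
  have [/pP/dvdpP [q pq]|b_root] := boolP (b \in undup rs).
    rewrite /D -[p](subrK (b^*)%:P) pq rmorphD rmorphM /= horner_mx_C.
    rewrite mulmxDr mul_mx_scalar (comm_horner_mx2 (A x) q) -mulmxE mulmxA vb.
    by rewrite mul0mx add0r.
  (* If [b] is not an eigenvalue, the power of ['X - b] is coprime to the characteristic polynomial,
     so a vector that it kills is zero. *)
  suff -> : r v = 0 by rewrite mul0mx scaler0.
  have : coprimep (char_poly (A x)) (('X - b%:P) ^+ N).
    by rewrite coprimep_expr // coprimep_XsubC chi_root.
  case/Bezout_eq1_coprimepP => -[t q] /= tq.
  have := congr1 (fun q => r v *m horner_mx (A x) q) tq => /=.
  rewrite rmorphD !rmorphM rmorph1 /= Cayley_Hamilton mulr0 add0r mulmx1 => <-.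
  by rewrite (comm_horner_mx2 (A x) q) -mulmxE mulmxA vb mul0mx.
(* By additivity it is enough to treat generalized eigenvectors for [a] and [b], where both sides
   are the conjugate of [a + b] times [[u, v]]. *)
have der u v : d (lie u v) = lie (d u) v + lie u (d v).
  elim/(@generalized_eigenvector_ind x): u => [|u1 u2 IH1 IH2|a u ua].
  - by rewrite lieC linear0 oppr0 d0 lieC linear0 oppr0 lieC linear0 oppr0 addr0.
  - by rewrite lieDl !dD !lieDl IH1 IH2 addrACA.
  elim/(@generalized_eigenvector_ind x): v => [|v1 v2 IH1 IH2|b v vb].
  - by rewrite d0 !linear0 d0 addr0.
  - by rewrite linearD !dD !linearD /= IH1 IH2 addrACA.
  rewrite (dE _ _ (generalized_eigenvector_bracket ua vb)).
  have weak c w : iter n.+1 (fun v => lie x v - c *: v) w = 0 ->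
      d w = c^* *: w.
    move=> wc; apply: dE; apply: (can_inj rK).
    rewrite shifted_ad_iter exprD rmorphM /= -mulmxE mulmxA -shifted_ad_iter.
    by rewrite wc linear0 mul0mx.
  by rewrite (weak _ _ ua) (weak _ _ vb) lieZl linearZ /= -scalerDl rmorphD.
(* The derivation rule in matrix form: the commutator of [D] with [ad u] is [ad (d u)]. *)
have ldA u : A u *m D - D *m A u = A (d u).
  apply: mx_ext => w; rewrite -rA mulmxBr !mulmxA -!rA.
  apply/eqP; rewrite subr_eq; apply/eqP.
  have := congr1 r (der u w); rewrite linearD /= {1}/d r'K => ->.
  by rewrite !rA /d !r'K.
have Alin : linear A.
  move=> k u v; apply: mx_ext => w.
  by rewrite -rA lieDl lieZl linearP !rA mulmxDr -scalemxAr.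
have Abr u v : A (lie u v) = A v *m A u - A u *m A v.
  apply: mx_ext => w; rewrite -rA lie_bracketl linearB /= !rA.
  by rewrite mulmxBr !mulmxA.
(* By cyclicity, the trace of [ad [u, v]] against [D] is the trace form at [v] and [d u], which
   vanishes by assumption. *)
have l0 : \tr (A x *m D) = 0.
  apply: (perfect (fun u => \tr (A u *m D))).
    by move=> k u v; rewrite Alin mulmxDl -scalemxAl linearD linearZ.
  move=> u v; rewrite Abr mulmxBl linearB /= -!mulmxA (mxtrace_mulC (A u)) -mulmxA.
  by rewrite -(tr0 v (d u)) -ldA mulmxBr linearB.
have p_root b : root (char_poly (A x)) b -> p.[b] = b^*.
  rewrite chi_root => /pP/dvdpP [q /(congr1 (horner^~ b))] /eqP.
  by rewrite !hornerE subrr expr0n mulr0 subr_eq0 => /eqP.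
have nilA := trace_conj_nilpotent p_root l0.
move=> v; apply: (can_inj rK); rewrite linear0.
have := shifted_ad_iter x 0 n.+1 v; rewrite polyC0 subr0 rmorphXn /= horner_mx_X nilA mulmx0.
have -> k : iter k (fun v => lie x v - 0 *: v) v = iter k (lie x) v.
  by elim: k => //= k ->; rewrite scale0r subr0.
by rewrite scale0r subr0.
Qed.

End CartanCriterion.

Theorem cartan_nilpotent (C : numClosedFieldType) (n : nat) (L : lieAlgType C)
    (r : {linear L -> 'rV[C]_n}) (r' : 'rV[C]_n -> L) (A : L -> 'M[C]_n) :
    cancel r r' -> cancel r' r -> (forall x v, r (lie x v) = r v *m A x) ->
    (forall u v, \tr (A u *m A v) = 0) ->
    (forall l : L -> C^o, linear l -> (forall u v : L, l (lie u v) = 0) ->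
      forall x, l x = 0) ->
  forall x, exists N, forall v : L, iter N (lie x) v = 0.
Proof.
case: n r r' A => [|n] r r' A rK r'K rA tr0 perfect x; last first.
  by exists n.+1; apply: (ad_nilpotent_pos_dim rK r'K rA).
by exists 0%N => v; apply: (can_inj rK); rewrite !thinmx0.
Qed.

(** * Complexification *)

Section RealImaginaryParts.
Variables (R : rcfType) (V : vectType R).
Local Notation VC := (complexification V).
Local Notation toc := (@to_complexification R V).
Implicit Types (x y : V) (z w : VC).

Definition re_part z : V := \sum_i complex.Re (z i) *: tensor_basis i.
Definition im_part z : V := \sum_i complex.Im (z i) *: tensor_basis i.

Lemma to_complexificationE x i : toc x i = (coord (vbasis {:V}) i x)%:C%C.
Proof. by rewrite ffunE; apply/eqP; rewrite eq_complex /= mulr1 mulr0 !eqxx. Qed.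

Lemma complexificationP (c : R[i]) z w i : (c *: z + w) i = c * z i + w i.
Proof. by rewrite [LHS]ffunE; congr (_ + _); rewrite ffunE. Qed.

Lemma complexificationZ (c : R[i]) z i : (c *: z) i = c * z i.
Proof. by rewrite ffunE. Qed.

Lemma to_complexificationP (a : R) x y : toc (a *: x + y) = a%:C%C *: toc x + toc y.
Proof.
apply/ffunP => i; rewrite complexificationP !to_complexificationE.
by rewrite linearP rmorphD rmorphM.
Qed.

Lemma to_complexificationD x y : toc (x + y) = toc x + toc y.
Proof. by have := to_complexificationP 1 x y; rewrite !scale1r. Qed.

Lemma to_complexification0 : toc 0 = 0.
Proof. by apply: (addrI (toc 0)); rewrite -to_complexificationD !addr0. Qed.

Lemma to_complexificationN x : toc (- x) = - toc x.
Proof.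
by apply: (addrI (toc x)); rewrite -to_complexificationD !subrr to_complexification0.
Qed.

Lemma coord_tensor_basis (c : 'I_(\dim {:V}) -> R) i :
  coord (vbasis {:V}) i (\sum_k c k *: tensor_basis k) = c i.
Proof. by rewrite /tensor_basis coord_sum_free // (basis_free (vbasisP _)). Qed.

Lemma complexification_reim z : z = toc (re_part z) + 'i%C *: toc (im_part z).
Proof.
apply/ffunP => i; rewrite addrC complexificationP !to_complexificationE.
rewrite !coord_tensor_basis; apply/eqP; rewrite eq_complex /=.
by apply/andP; split; apply/eqP; ring.
Qed.

Lemma re_partE x y : re_part (toc x + 'i%C *: toc y) = x.
Proof.
rewrite [RHS](basis_expand x) /re_part; apply: eq_bigr => i _; congr (_ *: _).
by rewrite addrC complexificationP !to_complexificationE /=; ring.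
Qed.

Lemma im_partE x y : im_part (toc x + 'i%C *: toc y) = y.
Proof.
rewrite [RHS](basis_expand y) /im_part; apply: eq_bigr => i _; congr (_ *: _).
by rewrite addrC complexificationP !to_complexificationE /=; ring.
Qed.

Lemma re_part_toc x : re_part (toc x) = x.
Proof. by have := re_partE x 0; rewrite to_complexification0 scaler0 addr0. Qed.

Lemma im_part_toc x : im_part (toc x) = 0.
Proof. by have := im_partE x 0; rewrite to_complexification0 scaler0 addr0. Qed.

Lemma to_complexification_inj : injective toc.
Proof. exact: can_inj re_part_toc. Qed.

Lemma re_partD z w : re_part (z + w) = re_part z + re_part w.
Proof.
rewrite {1}(complexification_reim z) {1}(complexification_reim w) addrACA.
by rewrite -to_complexificationD -scalerDr -to_complexificationD re_partE.
Qed.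

Lemma im_partD z w : im_part (z + w) = im_part z + im_part w.
Proof.
rewrite {1}(complexification_reim z) {1}(complexification_reim w) addrACA.
by rewrite -to_complexificationD -scalerDr -to_complexificationD im_partE.
Qed.

Lemma re_partZ (a b : R) z :
  re_part ((a +i* b)%C *: z) = a *: re_part z - b *: im_part z.
Proof.
rewrite /re_part /im_part !scaler_sumr -sumrB; apply: eq_bigr => i _.
by rewrite !scalerA -scalerBl ffunE; case: (z i).
Qed.

Lemma im_partZ (a b : R) z :
  im_part ((a +i* b)%C *: z) = a *: im_part z + b *: re_part z.
Proof.
rewrite /re_part /im_part !scaler_sumr -big_split; apply: eq_bigr => i _ /=.
by rewrite !scalerA -scalerDl ffunE; case: (z i).
Qed.

Lemma reim_eq z w : re_part z = re_part w -> im_part z = im_part w -> z = w.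
Proof. by move=> zw1 zw2; rewrite (complexification_reim z) zw1 zw2 -complexification_reim. Qed.

End RealImaginaryParts.

(* Locked, and so is [complexify] below: unification would otherwise unfold it
   down to sums of finite functions. *)
HB.lock Definition conj_complexification (R : rcfType) (V : vectType R)
    (z : complexification V) : complexification V :=
  to_complexification (re_part z) - 'i%C *: to_complexification (im_part z).

Section Conjugation.
Variables (R : rcfType) (V : vectType R).
Local Notation VC := (complexification V).
Local Notation toc := (@to_complexification R V).
Implicit Types (x y : V) (z w : VC).

Lemma re_conj z : re_part (conj_complexification z) = re_part z.
Proof. by rewrite unlock -scalerN -to_complexificationN re_partE. Qed.

Lemma im_conj z : im_part (conj_complexification z) = - im_part z.
Proof. by rewrite unlock -scalerN -to_complexificationN im_partE. Qed.

(** Every vector is [u + i v] with [u], [v] real, so fixing the real vectors determines [s] on the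
    image of [f]. The map [f] allows both the complexification itself and its isomorphic copy
    [g]. *)
Lemma semilinear_conj (E : lmodType R[i]) (f : {linear VC -> E}) (s : E -> E) :
  semilinear_action s -> (forall x, s (f (toc x)) = f (toc x)) ->
  forall z, s (f z) = f (conj_complexification z).
Proof.
move=> [slin _] sf z; rewrite {1}(complexification_reim z) addrC linearD linearZ /= slin.
have -> : conjc 'i%C = - 'i%C :> R[i].
  by apply/eqP; rewrite eq_complex /= oppr0 !eqxx.
by rewrite !sf unlock linearB linearZ /= scaleNr addrC.
Qed.

End Conjugation.

HB.lock Definition complexify (R : rcfType) (V W : vectType R) (f : V -> W)
    (z : complexification V) : complexification W :=
  to_complexification (f (re_part z)) + 'i%C *: to_complexification (f (im_part z)).

Section Lift.
Variables (R : rcfType) (V W : vectType R) (f : V -> W).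
Local Notation complexify := (complexify f).
Hypothesis f_lin : linear f.

Lemma re_complexify z : re_part (complexify z) = f (re_part z).
Proof. by rewrite unlock re_partE. Qed.

Lemma im_complexify z : im_part (complexify z) = f (im_part z).
Proof. by rewrite unlock im_partE. Qed.

Lemma complexify_linear : linear complexify.
Proof.
have fD u v : f (u + v) = f u + f v by have := f_lin 1 u v; rewrite !scale1r.
have f0 : f 0 = 0 by apply: (addrI (f 0)); rewrite -fD !addr0.
have fZ k u : f (k *: u) = k *: f u by have := f_lin k u 0; rewrite f0 !addr0.
move=> [a b] z w; apply: reim_eq.
  rewrite re_complexify re_partD re_partZ [RHS]re_partD re_partZ.
  by rewrite !re_complexify im_complexify -!scaleNr !(fD, fZ).
rewrite im_complexify im_partD im_partZ [RHS]im_partD im_partZ.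
rewrite !im_complexify re_complexify.
by rewrite !(fD, fZ).
Qed.

Lemma complexify_toc x : complexify (to_complexification x) = to_complexification (f x).
Proof.
have f0 : f 0 = 0.
  by apply: (addrI (f 0)); have := f_lin 1 0 0; rewrite !scale1r !addr0.
by rewrite unlock re_part_toc im_part_toc f0 to_complexification0 scaler0 addr0.
Qed.

End Lift.

Section ComplexLie.
Variables (R : rcfType) (L : lieAlgType R).
Local Notation toc := (@to_complexification R L).
Implicit Types (z w : complexification L).

Lemma to_complexification_lie (x y : L) : toc (lie x y) = lie (toc x) (toc y).
Proof.
have := @tensor_lie_pure R (Rcomplex R) L x y 1 1.
by rewrite mulr1 => h; apply: esym h.
Qed.

Lemma scaleii (u : complexification L) : 'i%C *: ('i%C *: u) = - u.
Proof.
rewrite scalerA -scaleN1r; congr (_ *: _).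
by apply/eqP; rewrite eq_complex /=; apply/andP; split; apply/eqP; ring.
Qed.

Lemma lie_reim z w : lie z w =
  toc (lie (re_part z) (re_part w) - lie (im_part z) (im_part w)) +
  'i%C *: toc (lie (re_part z) (im_part w) + lie (im_part z) (re_part w)).
Proof.
rewrite {1}(complexification_reim z) {1}(complexification_reim w).
rewrite lieDl !linearD !linearZ /= !lieZl scaleii -!to_complexification_lie.
rewrite !to_complexificationD to_complexificationN scalerDr.
by rewrite [RHS]addrAC !addrA.
Qed.

Lemma re_lie z w : re_part (lie z w) =
  lie (re_part z) (re_part w) - lie (im_part z) (im_part w).
Proof. by rewrite lie_reim re_partE. Qed.

Lemma im_lie z w : im_part (lie z w) =
  lie (re_part z) (im_part w) + lie (im_part z) (re_part w).
Proof. by rewrite lie_reim im_partE. Qed.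

Lemma conj_complexification_lie z w :
  conj_complexification (lie z w) =
  lie (conj_complexification z) (conj_complexification w).
Proof.
apply: reim_eq; rewrite (re_lie, im_lie) !(re_conj, im_conj) (re_lie, im_lie).
  by rewrite lieNl lieNr opprK.
by rewrite lieNl lieNr opprD.
Qed.

Lemma complexify_commute (f : L -> L) : linear f ->
  (forall x y, f (lie x y) = lie x (f y)) ->
  forall z w, complexify f (lie z w) = lie z (complexify f w).
Proof.
move=> f_lin fad z w.
have fD u v : f (u + v) = f u + f v by have := f_lin 1 u v; rewrite !scale1r.
have fB u v : f (u - v) = f u - f v.
  by apply: (addIr (f v)); rewrite -fD !subrK.
apply: reim_eq; rewrite (re_lie, im_lie) !(re_complexify, im_complexify) (re_lie, im_lie).
  by rewrite fB !fad.
by rewrite fD !fad.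
Qed.

Lemma complexify_vanish (W : vectType R) (f : L -> W) : linear f ->
  (forall x y, f (lie x y) = 0) -> forall z w, complexify f (lie z w) = 0.
Proof.
move=> f_lin f0 z w.
have fD u v : f (u + v) = f u + f v by have := f_lin 1 u v; rewrite !scale1r.
rewrite unlock re_lie im_lie -linearN /= !fD !f0 addr0 to_complexification0.
by rewrite scaler0 addr0.
Qed.

End ComplexLie.

Lemma simple_lie_iso (K : fieldType) (L M : lieAlgType K) (f : 'Hom(L, M)) :
  lie_iso f -> simple_lie M -> simple_lie L.
Proof.
move=> [fh [h fK hK]] [[x [y n0]] idl]; split.
  exists (h x), (h y); apply: contraNneq n0 => /(congr1 f).
  by rewrite fh !hK linear0 => ->.
move=> U Uid; case: (idl (f @: U)%VS) => [a b /memv_imgP [u uU ->]||full].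
- by rewrite -(hK a) -fh memv_img // Uid.
- move=> /eqP; rewrite -subv0 => /subvP U0; left; apply/eqP; rewrite -subv0.
  apply/subvP => u uU; have := U0 _ (memv_img f uU); rewrite !memv0 => /eqP fu.
  by rewrite -(fK u) fu -(linear0 f) fK.
right; apply/eqP; rewrite eqEsubv subvf; apply/subvP => a _.
have : f a \in (f @: U)%VS by rewrite full memvf.
by case/memv_imgP => u uU /(can_inj fK) ->.
Qed.

(** * The Killing form of a real form *)

Section ScalarMaps.
Variables (K : pzRingType) (V : lmodType K) (f : V -> K).
Hypothesis f_scalar : scalar f.

Lemma scalarD_fun u v : f (u + v) = f u + f v.
Proof. by have := f_scalar 1 u v; rewrite scale1r mul1r. Qed.

Lemma scalar0_fun : f 0 = 0.
Proof. by apply: (addrI (f 0)); rewrite -scalarD_fun !addr0. Qed.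

Lemma scalarZ_fun a u : f (a *: u) = a * f u.
Proof. by have := f_scalar a u 0; rewrite scalar0_fun !addr0. Qed.

Lemma scalarN_fun u : f (- u) = - f u.
Proof. by rewrite -scaleN1r scalarZ_fun mulN1r. Qed.

Lemma scalar_sum (I : finType) (F : I -> V) : f (\sum_i F i) = \sum_i f (F i).
Proof. exact: (big_morph f scalarD_fun scalar0_fun). Qed.

End ScalarMaps.

Section AdjointMatrix.
Variables (K : fieldType) (L : lieAlgType K).
Local Notation n := (\dim {:L}).
Local Notation e := (vbasis {:L}).
Implicit Types x y z : L.

Let eP : basis_of {:L} e := vbasisP _.

Definition adjoint_mx x : 'M[K]_n := mxof e e (ad x).

Lemma adjoint_mxP x y : rVof e (lie x y) = rVof e y *m adjoint_mx x.
Proof. by rewrite -(rVof_app _ eP) lfunE. Qed.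

Lemma adjoint_mxE x i k : adjoint_mx x i k = coord e k (lie x (tensor_basis i)).
Proof.
have -> : lie x (tensor_basis i) = ad x (tensor_basis i) by rewrite lfunE.
rewrite coord_rVof (rVof_app _ eP) rVofE //.
by rewrite -rowE [RHS]mxE.
Qed.

Lemma killing_formE x y : killing_form x y = \tr (adjoint_mx y *m adjoint_mx x).
Proof. by rewrite /killing_form (mxof_comp _ _ eP). Qed.

Lemma adjoint_mx_lie x y : adjoint_mx (lie x y) =
  adjoint_mx y *m adjoint_mx x - adjoint_mx x *m adjoint_mx y.
Proof.
apply/row_matrixP => i; rewrite !rowE -(rVofE eP) mulmxBr !mulmxA.
by rewrite -!adjoint_mxP lie_bracketl linearB.
Qed.

Lemma adjoint_mx_linear : linear adjoint_mx.
Proof.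
move=> k x y; apply/row_matrixP => i; rewrite !rowE -(rVofE eP) mulmxDr -scalemxAr.
by rewrite -!adjoint_mxP lieDl lieZl linearP.
Qed.

Lemma killing_form_linearr x : scalar (killing_form x).
Proof.
by move=> k y z; rewrite !killing_formE adjoint_mx_linear mulmxDl -scalemxAl linearP.
Qed.

Lemma killing_formC x y : killing_form x y = killing_form y x.
Proof. by rewrite !killing_formE mxtrace_mulC. Qed.

Lemma killing_form_linearl y : scalar ((@killing_form K L)^~ y).
Proof.
by move=> k x z; rewrite /= !(killing_formC _ y) killing_form_linearr.
Qed.

Lemma killing_form_invariant x y z :
  killing_form (lie x y) z = killing_form x (lie y z).
Proof.
rewrite !killing_formE !adjoint_mx_lie mulmxBr mulmxBl !linearB /= !mulmxA.
by congr (_ - _); rewrite mxtrace_mulC mulmxA // mxtrace_mulC mulmxA.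
Qed.

End AdjointMatrix.

Section RealForm.
Variables (R : rcfType) (L : lieAlgType R).
Hypothesis simpleLC : simple_lie (complexification L).
Local Notation toc := (@to_complexification R L).
Local Notation n := (\dim {:L}).

Lemma simple_vanish_real (W : vectType R) (f : L -> W) :
  linear f -> (forall x y, f (lie x y) = 0) -> forall x, f x = 0.
Proof.
move=> f_lin f0 x.
have := simple_vanish simpleLC (complexify_linear f_lin) (complexify_vanish f_lin f0).
move=> /(_ (toc x)); rewrite complexify_toc // -(to_complexification0 W).
exact: to_complexification_inj.
Qed.

(** Schur's lemma is used on the complexification, over a closed field; on real vectors the real
    part of the complex scalar is enough. *)
Lemma simple_schur_real (f : L -> L) : linear f ->
  (forall x y, f (lie x y) = lie x (f y)) -> exists c, forall x, f x = c *: x.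
Proof.
move=> f_lin f_ad.
have [[a b] fc] := simple_schur simpleLC (complexify_linear f_lin)
  (complexify_commute f_lin f_ad).
exists a => x; have := congr1 (@re_part R L) (fc (toc x)).
by rewrite complexify_toc // re_partZ !re_part_toc im_part_toc scaler0 subr0.
Qed.

(** Otherwise the trace form of the complexification vanishes as well, each of its [ad z] is
    nilpotent, and Engel's theorem yields a nonzero central element. *)
Lemma killing_form_neq0 : ~ (forall x y : L, killing_form x y = 0).
Proof.
move=> K0; pose LC := complexification L.
(* Complex coordinates along the real basis, so that [A] restricts to the real adjoint matrices. *)
pose r0 (z : LC) : 'rV[R[i]]_n := \row_i z i.
pose r' (v : 'rV[R[i]]_n) : LC := [ffun i => v 0 i].
have r_lin : linear r0.
  by move=> c z w; apply/rowP => i; rewrite !mxE complexificationP.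
pose rL := GRing.isLinear.Build R[i] LC 'rV[R[i]]_n *:%R r0 r_lin.
pose r : {linear LC -> 'rV[R[i]]_n} := HB.pack r0 rL.
have rK : cancel r r' by move=> z; apply/ffunP => i; rewrite ffunE mxE.
have r'K : cancel r' r by move=> v; apply/rowP => i; rewrite mxE ffunE.
pose E i : LC := toc (tensor_basis i).
pose A (z : LC) : 'M[R[i]]_n := \matrix_(i, k) (lie z (E i)) k.
have LE (z : LC) : z = \sum_i z i *: E i.
  apply/ffunP => k; rewrite sum_ffunE (bigD1 k) //= big1 => [|i ik].
    rewrite complexificationZ to_complexificationE.
    rewrite coord_free ?(basis_free (vbasisP _)) //.
    by rewrite eqxx rmorph1 mulr1 addr0.
  rewrite complexificationZ to_complexificationE.
  rewrite coord_free ?(basis_free (vbasisP _)) //.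
  by rewrite (negPf ik) rmorph0 mulr0.
have rA x v : r (lie x v) = r v *m A x.
  apply/rowP => k; rewrite !mxE {1}(LE v) linear_sum sum_ffunE.
  by apply: eq_bigr => i _; rewrite linearZ ffunE !mxE.
have A_toc x : A (toc x) = map_mx (real_complex R) (adjoint_mx x).
  apply/matrixP => i k; rewrite [LHS]mxE [RHS]mxE adjoint_mxE.
  by rewrite -to_complexification_lie to_complexificationE.
have A_lin k u v : A (k *: u + v) = k *: A u + A v.
  apply/matrixP => i j; rewrite !mxE lieDl lieZl complexificationP.
  by [].
have trE u v : \tr (A u *m A v) = 0.
  have tr1 x : \tr (A (toc x) *m A v) = 0.
    rewrite (complexification_reim v) addrC A_lin -[A (toc (re_part v))]scale1r.
    rewrite mulmxDr -!scalemxAr linearD !linearZ /= !A_toc -!map_mxM !trace_map_mx.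
    by rewrite -!killing_formE !K0 !rmorph0 !mulr0 addr0.
  rewrite (complexification_reim u) addrC A_lin mulmxDl -scalemxAl linearD linearZ.
  by rewrite /= !tr1 mulr0 addr0.
have nilp := cartan_nilpotent rK r'K rA trE (fun l => simple_vanish simpleLC (f := l)).
have [z /eqP z0 zC] := engel nilp (simple_dim_gt0 simpleLC).
exact: z0 (simple_center simpleLC zC).
Qed.

Lemma invariant_form_killing (B : L -> L -> R) :
    (forall y, scalar (B^~ y)) -> (forall x, scalar (B x)) ->
    (forall x y z, B (lie x y) z = B x (lie y z)) ->
    (forall x, (forall y, B x y = 0) -> x = 0) ->
  exists nu, forall x y, B x y = nu * killing_form x y.
Proof.
move=> Bl Br Binv Bnd; pose e := vbasis {:L}; have eP : basis_of {:L} e := vbasisP _.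
pose K := @killing_form R L.
pose G b : 'M[R]_n := \matrix_(i, k) b (tensor_basis i) (tensor_basis k) : 'M[R]_n.
have form (b : L -> L -> R) : (forall y, scalar (b^~ y)) -> (forall x, scalar (b x)) ->
    forall x y, b x y = (rVof e x *m G b *m (rVof e y)^T) 0 0.
  move=> bl br x y; rewrite {1}(basis_expand x) (scalar_sum (bl y)).
  rewrite -mulmxA mxE; apply: eq_bigr => i _; rewrite (scalarZ_fun (bl y)) mxE; congr (_ * _).
  rewrite {1}(basis_expand y) (scalar_sum (br _)) mxE; apply: eq_bigr => k _.
  by rewrite (scalarZ_fun (br _)) !mxE mulrC.
(* A row vector killed by the Gram matrix represents a vector orthogonal to everything. *)
have G_unit : G B \in unitmx.
  rewrite -row_free_unit -kermx_eq0; apply/rowV0P => v /sub_kermxP vG.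
  rewrite -[v](vecofK eP); apply/eqP; rewrite rVof_eq0 //; apply/eqP.
  by apply: Bnd => y; rewrite (form B) // (vecofK eP) vG mul0mx mxE.
(* The solution in coordinates of [B (T x, y) = K (x, y)]. *)
pose T (x : L) : L := vecof e (rVof e x *m G K *m invmx (G B)).
have BT x y : B (T x) y = K x y.
  rewrite (form B) // (vecofK eP) mulmxKV // -form // => z.
    exact: killing_form_linearl.
  exact: killing_form_linearr.
have T_lin : linear T by move=> k x y; rewrite /T linearP !mulmxDl -!scalemxAl linearP.
have BN x y : B (- x) y = - B x y := scalarN_fun (Bl y) x.
(* By invariance of both forms, each side has [B]-product [- K (y, [x, z])] with [z]. *)
have T_ad x y : T (lie x y) = lie x (T y).
  apply/eqP; rewrite -subr_eq0; apply/eqP; apply: Bnd => z.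
  have := Bl z 1 (T (lie x y)) (- lie x (T y)); rewrite scale1r mul1r => ->.
  rewrite BT BN !(lieC x) BN opprK Binv BT /K killing_formC.
  by rewrite (scalarN_fun (killing_form_linearr z)) killing_formC
    killing_form_invariant addNr.
have [c Tc] := simple_schur_real T_lin T_ad.
have BTc x y : K x y = c * B x y by rewrite -BT Tc (scalarZ_fun (Bl y)).
have c0 : c != 0.
  apply/eqP => c0; apply: killing_form_neq0 => x y.
  by rewrite -/(K x y) BTc c0 mul0r.
by exists c^-1 => x y; rewrite -/(K x y) BTc mulKf.
Qed.

End RealForm.

(** * Tensor products with quadratic algebras *)

Section TensorFacts.
Variables (K : fieldType) (V : vectType K) (A : finComAlgType K).

Lemma pure_tensorDl (x y : V) (a : A) : (x + y) \ox a = x \ox a + y \ox a.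
Proof. by have := pure_tensor_linearl a 1 x y; rewrite !scale1r. Qed.

Lemma pure_tensor0l (a : A) : (0 : V) \ox a = 0.
Proof. by apply: (addrI ((0 : V) \ox a)); rewrite -pure_tensorDl !addr0. Qed.

Lemma pure_tensorZl (k : K) (x : V) (a : A) : (k *: x) \ox a = k *: (x \ox a).
Proof.
by have := pure_tensor_linearl a k x 0; rewrite pure_tensor0l !addr0.
Qed.

Lemma pure_tensorZr (k : K) (x : V) (a : A) : x \ox (k *: a) = k *: (x \ox a).
Proof. by rewrite linearZ. Qed.

Lemma pure_tensor_injr (x : V) : x != 0 -> injective (@pure_tensor K A V x).
Proof.
move=> x0 a b ab; apply: contraNeq x0 => neq_ab; apply/eqP.
rewrite [x]basis_expand big1 // => i _.
have /ffunP/(_ i)/eqP := ab; rewrite !ffunE -subr_eq0 -scalerBr scaler_eq0 subr_eq0.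
by rewrite (negPf neq_ab) orbF => /eqP ->; rewrite scale0r.
Qed.

End TensorFacts.

Lemma lie_pure_tensor (K : fieldType) (A : finComAlgType K) (L : lieAlgType K)
    (x y : L) (a b : A) :
  lie (x \ox a : tensor L A) (y \ox b : tensor L A) = lie x y \ox (a * b).
Proof. exact: tensor_lie_pure. Qed.

(** Each coordinate functional of [A] turns [T] into an endomorphism of [L] commuting with [ad],
    hence a scalar; these scalars are the coordinates of [a]. *)
Lemma tensor_schur (C : closedFieldType) (A : finComAlgType C) (L : lieAlgType C)
    (T : L -> tensor L A) : simple_lie L -> linear T ->
  (forall x y, T (lie x y) = lie (x \ox 1 : tensor L A) (T y)) ->
  exists a : A, forall x, T x = x \ox a.
Proof.
move=> simpleL T_lin T_ad; pose b := vbasis {:A}.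
pose p k (f : tensor L A) : L := \sum_i coord b k (f i) *: tensor_basis i.
have p_lin k : linear (p k).
  move=> c f h; rewrite /p scaler_sumr -big_split; apply: eq_bigr => i _ /=.
  by rewrite !ffunE linearP scalerDl scalerA.
have p_pure k x a : p k (x \ox a) = coord b k a *: x.
  rewrite /p [in RHS](basis_expand x) scaler_sumr; apply: eq_bigr => i _.
  by rewrite ffunE linearZ scalerA mulrC.
pose pk k : {linear tensor L A -> L} := HB.pack (p k)
  (GRing.isLinear.Build C (tensor L A) L *:%R (p k) (p_lin k)).
have p_ad k x f : pk k (lie (x \ox 1 : tensor L A) f) = lie x (pk k f).
  rewrite (tensor_expand f) (linear_sum (lie _)) !(linear_sum (pk k)).
  rewrite (linear_sum (lie x)); apply: eq_bigr => i _.
  transitivity (pk k (lie x (tensor_basis i) \ox f i)).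
    by congr (pk k _); rewrite -[in RHS](mul1r (f i)); apply: lie_pure_tensor.
  by rewrite /= !p_pure linearZ.
have p_sum f : f = \sum_k p k f \ox b`_k.
  apply/ffunP => i; rewrite sum_ffunE [LHS](coord_vbasis (memvf _)).
  apply: eq_bigr => k _; rewrite ffunE.
  by rewrite coord_sum_free ?(basis_free (vbasisP _)).
have pT k : exists c, forall x, pk k (T x) = c *: x.
  apply: simple_schur => // [c x y|x y]; first by rewrite T_lin linearP.
  by rewrite T_ad p_ad.
have [c cP] := fin_all_exists pT.
exists (\sum_k c k *: b`_k) => x; rewrite [LHS]p_sum linear_sum.
apply: eq_bigr => k _.
by rewrite -[p k (T x)]/(pk k (T x)) cP pure_tensorZl linearZ.
Qed.

(** [c0] and [c1] express that [1, J] is a basis of [A]; their linearity follows from the two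
    equations. This treats the real algebras and the complex ones alike. *)
Definition quadratic_generator (K : fieldType) (A : finComAlgType K) (J : A) (c : K) :=
  J * J = c *: 1 /\ exists c0 c1 : A -> K,
    (forall a, a = c0 a *: 1 + c1 a *: J) /\
    (forall k l, c0 (k *: 1 + l *: J) = k /\ c1 (k *: 1 + l *: J) = l).

Lemma quadratic_generatorZ (K : fieldType) (A : finComAlgType K) (J : A) (c k : K) :
  k != 0 -> quadratic_generator J c -> quadratic_generator (k *: J) (k ^+ 2 * c).
Proof.
move=> k0 [JJ [c0 [c1 [cE cP]]]]; split.
  by rewrite -scalerAl -scalerAr JJ !scalerA expr2.
exists c0, (fun a => k^-1 * c1 a); split=> [a|l m].
  by rewrite scalerA mulrAC mulVf // mul1r -cE.
by rewrite scalerA; have [-> ->] := cP l (m * k); rewrite mulrCA mulVf ?mulr1.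
Qed.

Lemma quadratic_generator_poly (K : fieldType) (h : {poly K}) (c : K) :
  h = 'X^2 - c%:P ->
  @quadratic_generator K ({poly %/ h} : finComAlgType K) ('qX : {poly %/ h}) c.
Proof.
move=> hE.
have szh : size h = 3%N.
  by rewrite hE size_polyDl size_polyXn // size_polyN (leq_ltn_trans (size_polyC_leq1 c)).
have mh : h \is monic.
  by rewrite monicE lead_coefE szh hE coefB coefXn coefC subr0.
(* [{poly %/ h}] is the quotient by [mk_monic h], which defaults to ['X] unless [h] is monic of
   positive degree. *)
have mk : mk_monic h = h by rewrite /mk_monic szh mh.
have vX : ('qX : {poly %/ h}) = 'X :> {poly K} by rewrite qpolyXE ?szh.
have v1 : (1 : {poly %/ h}) = 1 :> {poly K} by [].
split.
  have h0 : in_qpoly h h = 0.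
    by apply: val_inj; rewrite /= mk Pdiv.RingMonic.rmodpp.
  rewrite -[LHS](in_qpolyM h 'X 'X) -expr2 -['X^2](subrK c%:P) -hE in_qpolyD h0 add0r.
  by rewrite -[c%:P]mulr1 mul_polyC in_qpolyZ in_qpoly1.
exists (fun a : {poly %/ h} => (val a)`_0), (fun a : {poly %/ h} => (val a)`_1).
have coefE k l i : (val (k *: (1 : {poly %/ h}) + l *: ('qX : {poly %/ h})))`_i
    = (k *: 1 + l *: 'X)`_i :> K by rewrite -vX.
split=> [a|k l].
  apply/val_inj/polyP => i; rewrite coefE coefD !coefZ coef1 coefX.
  case: i => [|[|i]]; rewrite ?mulr1 ?mulr0 ?addr0 ?add0r //.
  by rewrite nth_default // -ltnS (leq_trans (size_mk_monic a)) // mk szh.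
by rewrite !coefE !coefD !coefZ !coef1 !coefX !mulr1 !mulr0 addr0 add0r.
Qed.

Lemma quadratic_generator_complex (R : rcfType) :
  @quadratic_generator R (Rcomplex R) 'i%C (-1).
Proof.
split.
  by apply/eqP; rewrite eq_complex /=; apply/andP; split; apply/eqP; ring.
exists (@complex.Re R), (@complex.Im R); split=> [[a b]|k l].
  by apply/eqP; rewrite eq_complex /=; apply/andP; split; apply/eqP; ring.
by rewrite /=; split; ring.
Qed.

Section QuadraticTensor.
Variables (K : fieldType) (A : finComAlgType K) (J : A) (c : K).
Hypothesis quadJ : quadratic_generator J c.

Lemma quadratic_tensor_coord (V : vectType K) : exists q0 q1 : tensor V A -> V,
  (forall f, f = q0 f \ox 1 + q1 f \ox J) /\
  (forall x y, q0 (x \ox 1 + y \ox J) = x /\ q1 (x \ox 1 + y \ox J) = y).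
Proof.
have [_ [c0 [c1 [cE cP]]]] := quadJ.
exists (fun f => \sum_i c0 (f i) *: tensor_basis i),
  (fun f => \sum_i c1 (f i) *: tensor_basis i); split=> [f|x y].
  apply/ffunP => i; rewrite !ffunE !coord_sum_free ?(basis_free (vbasisP _)) //.
split; rewrite [RHS]basis_expand; apply: eq_bigr => i _; rewrite !ffunE.
  by have [-> _] := cP (coord (vbasis {:V}) i x) (coord (vbasis {:V}) i y).
by have [_ ->] := cP (coord (vbasis {:V}) i x) (coord (vbasis {:V}) i y).
Qed.

Lemma quadratic_tensor_inj (V : vectType K) (x y x' y' : V) :
  x \ox 1 + y \ox J = x' \ox 1 + y' \ox J -> x = x' /\ y = y'.
Proof.
have [q0 [q1 [_ qP]]] := quadratic_tensor_coord V => xy.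
by move: (qP x y); rewrite xy; case: (qP x' y') => -> -> [-> ->].
Qed.

Lemma quadratic_tensor_lie (L : lieAlgType K) (x y x' y' : L) :
  lie (x \ox 1 + y \ox J : tensor L A) (x' \ox 1 + y' \ox J : tensor L A) =
  (lie x x' + c *: lie y y') \ox 1 + (lie x y' + lie y x') \ox J.
Proof.
have [JJ _] := quadJ.
rewrite lieDl !linearD /= !lie_pure_tensor !mul1r mulr1 JJ !pure_tensorDl.
rewrite pure_tensorZr pure_tensorZl -!addrA; congr (_ + _).
by rewrite addrA [RHS]addrC.
Qed.

(** Here [jJ] plays the role of [y |-> y J], and the bracket rules are those of [tensor g A]. The
    isomorphism is built from [tensor g A], where coordinates are explicit, and then inverted. *)
Lemma quadratic_double (g d : lieAlgType K) (j : 'Hom(g, d)) (jJ : g -> d) :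
    linear jJ ->
    (forall x y, lie (j x) (j y) = j (lie x y)) ->
    (forall x y, lie (j x) (jJ y) = jJ (lie x y)) ->
    (forall x y, lie (jJ x) (jJ y) = c *: j (lie x y)) ->
    (forall z, exists x y, z = j x + jJ y) ->
    (forall x y, j x + jJ y = 0 -> x = 0 /\ y = 0) ->
  exists psi : 'Hom(d, tensor g A),
    lie_iso psi /\ (forall x, psi (j x) = x \ox 1).
Proof.
move=> jJ_lin jj jjJ jJjJ gen indep.
have [q0 [q1 [qE qP]]] := quadratic_tensor_coord g.
have jJD x y : jJ (x + y) = jJ x + jJ y by have := jJ_lin 1 x y; rewrite !scale1r.
have jJ0 : jJ 0 = 0 by apply: (addrI (jJ 0)); rewrite -jJD !addr0.
have jJZ k x : jJ (k *: x) = k *: jJ x by have := jJ_lin k x 0; rewrite jJ0 !addr0.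
pose chi f := j (q0 f) + jJ (q1 f).
have chiP x y : chi (x \ox 1 + y \ox J) = j x + jJ y.
  by rewrite /chi; have [-> ->] := qP x y.
have chi_lin : linear chi.
  move=> k f h; rewrite (qE f) (qE h) !chiP scalerDr -!pure_tensorZl addrACA.
  by rewrite -!pure_tensorDl chiP linearP jJ_lin scalerDr addrACA.
have chi_lie f h : chi (lie f h) = lie (chi f) (chi h).
  rewrite (qE f) (qE h) quadratic_tensor_lie !chiP.
  set x := q0 f; set y := q1 f; set x' := q0 h; set y' := q1 h.
  rewrite lieDl !linearD linearZ /= jj jjJ jJjJ (lieC (jJ y)) jjJ.
  rewrite (lieC y x') jJD (_ : jJ (- lie x' y) = - jJ (lie x' y)); last first.
    by rewrite -scaleN1r jJZ scaleN1r.
  by rewrite [LHS]addrAC !addrA.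
pose l : {linear tensor g A -> d} := HB.pack chi
  (GRing.isLinear.Build K (tensor g A) d *:%R chi chi_lin).
pose chiH : 'Hom(tensor g A, d) := linfun l.
have chiHE f : chiH f = chi f by rewrite lfunE.
have inj : lker chiH == 0%VS.
  rewrite -subv0; apply/subvP => f; rewrite memv_ker chiHE memv0 => /eqP.
  by rewrite (qE f) chiP => /indep [-> ->]; rewrite !pure_tensor0l addr0.
have sur z : exists f, z = chi f.
  by have [x [y ->]] := gen z; exists (x \ox 1 + y \ox J); rewrite chiP.
have K1 : cancel chiH (chiH^-1)%VF by move=> f; rewrite lker0_lfunK.
have K2 : cancel (chiH^-1)%VF chiH.
  by move=> z; have [f ->] := sur z; rewrite -chiHE K1.
exists (chiH^-1)%VF; split; last first.
  move=> x; apply: (can_inj K1); rewrite K2 chiHE.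
  by have := chiP x 0; rewrite pure_tensor0l jJ0 !addr0.
split; last by exists chiH.
move=> z w; apply: (can_inj K1); rewrite K2 chiHE chi_lie.
by rewrite -!chiHE !K2.
Qed.

End QuadraticTensor.

(** * The double *)

(** The inverse provided by [bijective] is a bare function; this passes to the linear inverse. *)
Lemma bijective_lfunK (K : fieldType) (U V : vectType K) (f : 'Hom(U, V)) :
  bijective f -> cancel f (f^-1)%VF /\ cancel (f^-1)%VF f.
Proof.
move=> [h fK hK].
have K1 : cancel f (f^-1)%VF.
  apply: lker0_lfunK; rewrite -subv0; apply/subvP => u; rewrite memv_ker memv0.
  by move=> /eqP fu; rewrite -(fK u) fu -(linear0 f) fK.
by split=> // v; rewrite -{1}(hK v) K1 hK.
Qed.

Definition A_real_square (R : rcfType) (n : real_index) : R :=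
  match n with One => 0 | Two => 4%:R^-1 | Three => -1 end.

Lemma A_real_quadratic (R : rcfType) n :
  quadratic_generator (J_real R n) (A_real_square R n).
Proof.
case: n => /=; last exact: quadratic_generator_complex.
  by apply: quadratic_generator_poly; rewrite subr0.
exact: quadratic_generator_poly.
Qed.

(* The involution sends [J] to [a + b J]; involutivity gives [b <> 0] and [J ^ 2 = c]
   gives [2 a b = 0] and [a ^ 2 + b ^ 2 c = c], so [s J = b J] with [b ^ 2 c = c]. *)
Lemma fixed_quadratic_generator (R : rcfType) (A : finComAlgType R[i]) (J : A)
    (c : R[i]) (s : A -> A) :
  quadratic_generator J c -> (c = 0 \/ c = 4%:R^-1) ->
  semilinear_action s -> monoid_morphism s ->
  exists n (k : R[i]), [/\ k != 0, s (k *: J) = k *: J &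
    k ^+ 2 * c = (A_real_square R n)%:C%C].
Proof.
move=> [JJ [c0 [c1 [cE cP]]]] c_eq [s_lin sK] [s1 sM].
have uniq k l k' l' : k *: 1 + l *: J = k' *: 1 + l' *: J -> k = k' /\ l = l'.
  by move=> e; move: (cP k l); rewrite e; case: (cP k' l') => -> -> [-> ->].
have sD u v : s (u + v) = s u + s v by have := s_lin 1 u v; rewrite conjc1 !scale1r.
have s0 : s 0 = 0 by apply: (addrI (s 0)); rewrite -sD !addr0.
have sZ k u : s (k *: u) = conjc k *: s u by have := s_lin k u 0; rewrite s0 !addr0.
pose a := c0 (s J); pose b := c1 (s J).
have sJ : s J = a *: 1 + b *: J := cE (s J).
have [ab bb] : conjc a + conjc b * a = 0 /\ conjc b * b = 1.
  apply: uniq; rewrite scalerDl -!scalerA -addrA -scalerDr -sJ scale0r add0r scale1r.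
  by rewrite -{1}s1 -!sZ -sD -sJ sK.
have b0 : b != 0 by apply: contra_eq_neq bb => ->; rewrite mulr0 eq_sym oner_eq0.
have cc : conjc c = c.
  by case: c_eq => ->; rewrite ?conjc0 // conjc_inv conjc_nat.
have [e1 e2] : a * a + b * b * c = c /\ a * b + b * a = 0.
  apply: uniq; rewrite scale0r addr0.
  have <- : s J * s J = c *: 1 by rewrite -sM JJ sZ s1 cc.
  rewrite sJ mulrDl !mulrDr -!scalerAl -!scalerAr !mul1r mulr1 JJ !scalerA.
  by rewrite !scalerDl [LHS]addrAC !addrA.
have a0 : a = 0.
  move/eqP: e2; rewrite (mulrC b) -mulr2n mulrn_eq0 /= mulf_eq0 (negPf b0) orbF.
  by move/eqP.
rewrite a0 scale0r add0r in sJ.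
rewrite a0 mul0r add0r in e1.
have i0 : 'i%C != 0 :> R[i] by rewrite eq_complex /= oner_eq0 andbF.
have ci : conjc 'i%C = - 'i%C :> R[i].
  by apply/eqP; rewrite eq_complex /= oppr0 !eqxx.
have ii : 'i%C ^+ 2 = -1 :> R[i].
  by apply/eqP; rewrite expr2 eq_complex /=; apply/andP; split; apply/eqP; ring.
(* For [b = -1] an imaginary multiple of [J] is fixed: [i J], of square [0], if [c = 0], and
   [2 i J], of square [-1], if [c = 1/4]. *)
have [b1|b1] := eqVneq b (-1).
  case: c_eq => cE'.
    by exists One, 'i%C; rewrite i0 sZ sJ b1 ci scaleN1r scaleNr scalerN opprK cE' mulr0.
  exists Three, (2%:R * 'i%C); split.
  - by rewrite mulf_neq0 // pnatr_eq0.
  - rewrite sZ sJ b1 (_ : conjc _ = - (2%:R * 'i%C)); last first.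
      rewrite mulr_natl mulr2n raddfD /= -mulr2n; apply/eqP; rewrite eq_complex /=.
      by rewrite ?oppr0; apply/andP; split; apply/eqP; ring.
    by rewrite scaleN1r scaleNr scalerN opprK.
  - rewrite exprMn ii cE' rmorphN rmorph1 -natrX mulrN1 mulNr divff //.
    by rewrite pnatr_eq0.
(* If [c = 0], then [(1 + b) J] is fixed because [conj b * b = 1]; if [c = 1/4], then [b ^ 2 = 1]
   forces [b = 1] and [J] itself is fixed. *)
case: c_eq => cE'.
  exists One, (1 + b); split; last by rewrite cE' mulr0.
    by rewrite addrC addr_eq0.
  by rewrite sZ sJ scalerA rmorphD rmorph1 mulrDl mul1r bb addrC.
exists Two, 1; split; rewrite ?oner_eq0 //; last first.
  by rewrite expr1n mul1r cE' fmorphV rmorph_nat.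
rewrite sZ sJ conjc1 !scale1r.
have nc : c != 0 by rewrite cE' invr_eq0 pnatr_eq0.
have : b ^+ 2 == 1 by apply/eqP/(mulIf nc); rewrite expr2 e1 mul1r.
by rewrite sqrf_eq1 (negPf b1) orbF => /eqP ->; rewrite scale1r.
Qed.

(** * Galois descent from the complex double *)

Section RealDouble.
Variables (R : rcfType) (g : lieAlgType R[i]) (gR dR : lieAlgType R).
Variables (theta : 'Hom(complexification gR, g)) (j : 'Hom(gR, dR)).
Variables (A : finComAlgType R[i]) (phi : 'Hom(complexification dR, tensor g A)).
Variables (sd : complexification dR -> complexification dR) (sg : g -> g).
Hypotheses (g_simple : simple_lie g) (theta_iso : lie_iso theta).
Hypotheses (j_hom : lie_hom j) (phi_iso : lie_iso phi).
Hypothesis phi_g : forall x : gR, phi (to_complexification (j x))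
                          = theta (to_complexification x) \ox 1.
Hypothesis sd_action : semilinear_action sd.
Hypothesis sd_fixed : forall z, sd z = z <-> exists x : dR, z = to_complexification x.
Hypothesis sg_action : semilinear_action sg.
Hypothesis sg_fixed : forall z,
    sg z = z <-> exists x : gR, z = theta (to_complexification x).

Let toc := to_complexification.

Let phiK : cancel phi (phi^-1)%VF.
Proof. by case: phi_iso => _ /bijective_lfunK []. Qed.

Let phiVK : cancel (phi^-1)%VF phi.
Proof. by case: phi_iso => _ /bijective_lfunK []. Qed.

Let thetaK : cancel theta (theta^-1)%VF.
Proof. by case: theta_iso => _ /bijective_lfunK []. Qed.

Let thetaVK : cancel (theta^-1)%VF theta.
Proof. by case: theta_iso => _ /bijective_lfunK []. Qed.

(** Fixing the real vectors, the action must be complex conjugation. Compatibility of [sd], and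
    likewise of [sg], with brackets is deduced from this. *)
Let sdE z : sd z = conj_complexification z.
Proof.
apply: (semilinear_conj (f := idfun) sd_action) => x /=.
by apply/sd_fixed; exists x.
Qed.

Let sgE z : sg (theta z) = theta (conj_complexification z).
Proof.
apply: (semilinear_conj sg_action) => x.
by apply/sg_fixed; exists x.
Qed.

Let sg_lie x y : sg (lie x y) = lie (sg x) (sg y).
Proof.
have [th _] := theta_iso.
by rewrite -(thetaVK x) -(thetaVK y) -th !sgE conj_complexification_lie th.
Qed.

Let sigma f := phi (sd ((phi^-1)%VF f)).

Let sigma_lin c f h : sigma (c *: f + h) = conjc c *: sigma f + sigma h.
Proof. by have [sl _] := sd_action; rewrite /sigma linearP sl linearP. Qed.

Let sigma_lie f h : sigma (lie f h) = lie (sigma f) (sigma h).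
Proof.
have [ph _] := phi_iso.
by rewrite /sigma -{1}(phiVK f) -{1}(phiVK h) -ph phiK !sdE conj_complexification_lie ph.
Qed.

Let sigmaK : involutive sigma.
Proof. by have [_ sK] := sd_action; move=> f; rewrite /sigma phiK sK phiVK. Qed.

Let phi_j z : phi (complexify j z) = theta z \ox 1.
Proof.
rewrite complexify.unlock linearD linearZ /= !phi_g [in RHS](complexification_reim z).
by rewrite linearD linearZ /= pure_tensorDl pure_tensorZl.
Qed.

Let sigma1 x : sigma (x \ox 1) = sg x \ox 1.
Proof.
rewrite -(thetaVK x) -phi_j /sigma phiK sdE sgE -phi_j; congr (phi _).
apply: reim_eq; rewrite !(re_conj, im_conj, re_complexify, im_complexify) //.
by rewrite linearN.
Qed.

Lemma double_galois_action : exists s : A -> A,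
  [/\ semilinear_action s, monoid_morphism s
    & forall (x : g) (a : A), phi (sd ((phi^-1)%VF (x \ox a))) = sg x \ox s a].
Proof.
have [sg_lin sgK] := sg_action.
(* The two conjugations cancel, so the map is linear and [tensor_schur] applies. *)
have exa a : exists b : A, forall x, sigma (sg x \ox a) = x \ox b.
  apply: tensor_schur => // [c x y|x y].
    by rewrite sg_lin pure_tensorDl pure_tensorZl sigma_lin conjcK.
  by rewrite sg_lie -[a in LHS]mul1r -lie_pure_tensor sigma_lie sigma1 sgK.
have [[x0 [y0 z0]] _] := g_simple.
(* Reading off [s a] at one basis coordinate turns the existence of some [b] for each [a] into a
   function. *)
pose i0 := Ordinal (simple_dim_gt0 g_simple).
pose s a : A := sigma (sg (tensor_basis i0) \ox a) i0.
have sE x a : sigma (x \ox a) = sg x \ox s a.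
  have [b ab] := exa a; suff <- : b = s a by rewrite -ab sgK.
  by rewrite /s ab ffunE coord_free ?(basis_free (vbasisP _)) // eqxx scale1r.
(* Identities in [A] are tested on the nonzero vector [[x0, y0]]; its being a bracket gives access
   to products in [A]. *)
have inj z (nz : z != 0) (a b : A) : sg z \ox a = sg z \ox b -> a = b.
  apply: pure_tensor_injr; apply: contraNneq nz => sgz.
  rewrite -(sgK z) sgz; have := sg_lin (-1) 0 0.
  by rewrite rmorphN rmorph1 !scaleN1r oppr0 addr0 addNr => ->.
exists s; split=> //.
  split=> [c a b|a].
    apply: (inj _ z0); rewrite -sE linearP sigma_lin !sE.
    by rewrite [RHS]linearP.
  by apply: (inj _ z0); rewrite -sE -{1}(sgK (lie x0 y0)) -sE sigmaK.
split=> [|a b]; first by apply: (inj _ z0); rewrite -sE sigma1.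
by apply: (inj _ z0); rewrite -sE -lie_pure_tensor sigma_lie !sE lie_pure_tensor -sg_lie.
Qed.

Lemma real_double_iso : A = A1 R[i] \/ A = A2 R[i] ->
  exists (n : real_index) (psi : 'Hom(dR, tensor gR (A_real R n))),
    lie_iso psi /\ (forall x : gR, psi (j x) = x \ox 1).
Proof.
move=> A_eq; have [s [s_act s_mor sE]] := double_galois_action.
have [J [c [quadJ c_eq]]] : exists (J : A) c,
    quadratic_generator J c /\ (c = 0 \/ c = 4%:R^-1).
  case: A_eq => ->.
    exists ('qX : {poly %/ A1_poly R[i]}), 0; split; last by left.
    by apply: quadratic_generator_poly; rewrite subr0.
  exists ('qX : {poly %/ A2_poly R[i]}), 4%:R^-1; split; last by right.
  exact: quadratic_generator_poly.
have [n [k [k0 sk k2]]] := fixed_quadratic_generator quadJ c_eq s_act s_mor.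
have := quadratic_generatorZ k0 quadJ; rewrite k2; set K := k *: J => quadK.
rewrite -/K in sk; have [s1 _] := s_mor.
have [ph _] := phi_iso; have [th _] := theta_iso.
(* [E] and [t] embed the real algebras in [tensor g A] and [g]; being injective, they let identities
   be checked there. *)
pose E z := phi (toc z); pose t x := theta (toc x).
have E_inj : injective E by move=> z w /(can_inj phiK); apply: to_complexification_inj.
have E_lin (a : R) z w : E (a *: z + w) = a%:C%C *: E z + E w.
  by rewrite /E /toc to_complexificationP linearP.
have t_lin (a : R) x y : t (a *: x + y) = a%:C%C *: t x + t y.
  by rewrite /t /toc to_complexificationP linearP.
have E_lie z w : E (lie z w) = lie (E z) (E w).
  by rewrite /E /toc to_complexification_lie ph.
have t_lie x y : t (lie x y) = lie (t x) (t y).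
  by rewrite /t /toc to_complexification_lie th.
have Ej x : E (j x) = t x \ox 1 by rewrite /E /toc phi_g.
have E_fixed f : sigma f = f -> exists z, f = E z.
  move=> sf; have : sd ((phi^-1)%VF f) = (phi^-1)%VF f.
    by apply: (can_inj phiK); rewrite -[LHS]/(sigma f) sf phiVK.
  by move=> /sd_fixed [z zE]; exists z; rewrite /E /toc -zE phiVK.
have t_fixed x : sg (t x) = t x by apply/sg_fixed; exists x.
(* [t x \ox K] is fixed by the action, hence comes from a vector of [dR], recovered as a real
   part. *)
pose jK x := re_part ((phi^-1)%VF (t x \ox K)).
have EjK x : E (jK x) = t x \ox K.
  have [|z zE] := E_fixed (t x \ox K); first by rewrite /sigma sE t_fixed sk.
  by rewrite zE /jK zE /E phiK /toc re_part_toc.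
exists n; apply: (quadratic_double (A_real_quadratic R n) (jJ := jK)).
- move=> a x y; apply: E_inj.
  by rewrite E_lin !EjK t_lin pure_tensorDl pure_tensorZl.
- by move=> x y; rewrite j_hom.
- by move=> x y; apply: E_inj; rewrite E_lie Ej !EjK lie_pure_tensor mul1r t_lie.
- move=> x y; apply: E_inj; rewrite E_lie !EjK lie_pure_tensor.
  have := E_lin (A_real_square R n) (j (lie x y)) 0.
  have E0 : E 0 = 0 by rewrite /E /toc to_complexification0 linear0.
  rewrite E0 !addr0 => ->; rewrite Ej t_lie; have [-> _] := quadK.
  by rewrite pure_tensorZr.
(* For [z] in [dR], invariance and uniqueness of coordinates along [1, K] make both coordinates
   fixed by [sg], so they come from [gR]. *)
- move=> z; have [q0 [q1 [qE _]]] := quadratic_tensor_coord quadK g.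
  have : sigma (E z) = E z by rewrite /sigma /E phiK; congr (phi _); apply/sd_fixed; exists z.
  have sD f h : sigma (f + h) = sigma f + sigma h.
    by have := sigma_lin 1 f h; rewrite conjc1 !scale1r.
  rewrite {1}(qE (E z)) sD /sigma !sE s1 sk [in RHS](qE (E z)).
  move/(quadratic_tensor_inj quadK) => [/sg_fixed [x xE] /sg_fixed [y yE]].
  exists x, y; apply: E_inj; have := E_lin 1 (j x) (jK y); rewrite !scale1r => ->.
  by rewrite Ej EjK [LHS]qE xE yE.
move=> x y; have E0 : E 0 = 0 by rewrite /E /toc to_complexification0 linear0.
have t0 : t 0 = 0 by rewrite /t /toc to_complexification0 linear0.
have t_inj : injective t by move=> u v /(can_inj thetaK); apply: to_complexification_inj.
move/(congr1 E); have := E_lin 1 (j x) (jK y); rewrite !scale1r => ->.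
rewrite Ej EjK E0 => e; have [ex ey] : t x = 0 /\ t y = 0.
  by apply: (quadratic_tensor_inj quadK); rewrite e !pure_tensor0l addr0.
by split; apply: t_inj; rewrite t0.
Qed.

End RealDouble.

(** * Invariant forms on the double *)

(** Only the cross terms survive, and both are values of one invariant form [B], a multiple of the
    Killing form. Keeping [A] and [psi] arbitrary covers the three real algebras at once. *)
Lemma quadratic_double_form (R : rcfType) (g d : lieAlgType R) (j : 'Hom(g, d))
    (A : finComAlgType R) (J : A) (c : R) (psi : 'Hom(d, tensor g A))
    (Q : {symmetric d}) :
    simple_lie (complexification g) -> quadratic_generator J c ->
    lie_iso psi -> (forall x : g, psi (j x) = x \ox 1) ->
    nondegenerate Q -> ad_invariant Q -> isotropic Q (limg j) ->
  exists nu : R, forall a b a' b' : g,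
    Q ((psi^-1)%VF (a \ox 1 + b \ox J)) ((psi^-1)%VF (a' \ox 1 + b' \ox J))
    = nu * (killing_form a b' + killing_form b a').
Proof.
move=> simple quadJ [psi_hom /bijective_lfunK [psiK psiVK]] psi_j Qnd Qinv Qiso.
have Qsym u v : Q u v = Q v u by rewrite (hermC Q) expr0 mul1r.
have Qr u : scalar (Q u) by move=> k v w; rewrite linearPr.
have Ql v : scalar (Q^~ v) by move=> k u w; rewrite /= !(Qsym _ v) Qr.
have QDr u := scalarD_fun (Qr u); have QDl v := scalarD_fun (Ql v).
pose jJ y := (psi^-1)%VF (y \ox J).
have jJE y : psi (jJ y) = y \ox J by rewrite psiVK.
have psiV_add a b : (psi^-1)%VF (a \ox 1 + b \ox J) = j a + jJ b.
  by apply: (can_inj psiK); rewrite psiVK linearD /= psi_j jJE.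
have jJ_lin : linear jJ.
  move=> k x y; apply: (can_inj psiK).
  by rewrite jJE pure_tensorDl pure_tensorZl linearP /= !jJE.
have jjJ x y : lie (j x) (jJ y) = jJ (lie x y).
  by apply: (can_inj psiK); rewrite psi_hom psi_j !jJE lie_pure_tensor mul1r.
have jJj x y : lie (jJ x) (j y) = jJ (lie x y).
  by apply: (can_inj psiK); rewrite psi_hom psi_j !jJE lie_pure_tensor mulr1.
have jJjJ x y : lie (jJ x) (jJ y) = c *: j (lie x y).
  have [JJ _] := quadJ; apply: (can_inj psiK).
  by rewrite psi_hom !jJE lie_pure_tensor JJ pure_tensorZr linearZ /= psi_j.
have jj x y : lie (j x) (j y) = j (lie x y).
  by apply: (can_inj psiK); rewrite psi_hom !psi_j lie_pure_tensor mulr1.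
have Qjj x y : Q (j x) (j y) = 0.
  by move/orthovP: Qiso; apply; apply: memv_img; apply: memvf.
(* [g] is perfect and Q([jJ x, j y], jJ z) = - Q(j y, [jJ x, jJ z]) = 0. *)
have QjJjJ x z : Q (jJ x) (jJ z) = 0.
  apply: (@simple_vanish_real R g simple R^o (fun x => Q (jJ x) (jJ z))).
    by move=> k u v; rewrite jJ_lin Ql.
  move=> u v; rewrite -jJj lieC (scalarN_fun (Ql _)) Qinv jJjJ.
  by rewrite (scalarZ_fun (Qr _)) Qjj mulr0 oppr0.
pose B x y := Q (j x) (jJ y).
have [nu BE] : exists nu, forall x y, B x y = nu * killing_form x y.
  apply: (invariant_form_killing simple).
  - by move=> y k x x'; rewrite /B linearP Ql.
  - by move=> x k y y'; rewrite /B jJ_lin Qr.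
  - by move=> x y z; rewrite /B -jj Qinv jjJ.
  (* [B] is nondegenerate: if [j x] is orthogonal to every [jJ y], then by isotropy it is orthogonal
     to all of [d]. *)
  move=> x Bx; have : j x \in orthov Q fullv.
    apply/mem_orthovP => z _; have [q0 [q1 [qE _]]] := quadratic_tensor_coord quadJ g.
    rewrite -(psiK z) (qE (psi z)) psiV_add QDr Qjj add0r.
    exact: Bx.
  move/eqP: Qnd => ->; rewrite memv0 => /eqP jx0.
  have := psi_j x; rewrite jx0 linear0 => /esym.
  have := @quadratic_tensor_inj _ _ _ _ quadJ g x 0 0 0.
  by rewrite !pure_tensor0l !addr0 => inj /inj [].
exists nu => a b a' b'; rewrite !psiV_add QDl !QDr Qjj QjJjJ add0r addr0.
by rewrite (Qsym (jJ b)) -![Q (j _) _]/(B _ _) !BE -mulrDr (killing_formC a' b).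
Qed.

Theorem theorem2p2 (R : realType)
  (g : lieAlgType R[i]) (g_simple : simple_lie g)
  (* gR is a real form of g, embedded by x |-> theta (x (x) 1) *)
  (gR : lieAlgType R) (theta : 'Hom(complexification gR, g))
  (theta_iso : lie_iso theta)
  (* (gR, W, dR) is a Manin triple, gR being embedded in dR by j *)
  (dR : lieAlgType R) (j : 'Hom(gR, dR)) (W : {vspace dR}) (Q : {symmetric dR})
  (j_hom : lie_hom j) (j_inj : lker j = 0%VS)
  (manin : manin_triple (limg j) W Q)
  (* the identification of the complexification of dR with g (x) A *)
  (A : finComAlgType R[i]) (A_eq : A = A1 R[i] \/ A = A2 R[i])
  (phi : 'Hom(complexification dR, tensor g A))
  (phi_iso : lie_iso phi)
  (phi_g : forall x : gR, phi (to_complexification (j x))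
                          = theta (to_complexification x) \ox 1)
  (* the actions of Gal(C/R) *)
  (sd : complexification dR -> complexification dR)
  (sd_action : semilinear_action sd)
  (sd_fixed : forall z, sd z = z <-> exists x : dR, z = to_complexification x)
  (sg : g -> g)
  (sg_action : semilinear_action sg)
  (sg_fixed : forall z,
    sg z = z <-> exists x : gR, z = theta (to_complexification x)) :
  [/\ exists s : A -> A,
        [/\ semilinear_action s, monoid_morphism s
          & forall (x : g) (a : A),
              phi (sd ((phi^-1)%VF (x \ox a))) = sg x \ox s a],
      exists (n : real_index) (psi : 'Hom(dR, tensor gR (A_real R n))),
        lie_iso psi /\ (forall x : gR, psi (j x) = x \ox 1)
    & forall (n : real_index) (psi : 'Hom(dR, tensor gR (A_real R n))),
        lie_iso psi -> (forall x : gR, psi (j x) = x \ox 1) ->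
        forall QR : {symmetric dR},
          nondegenerate QR -> ad_invariant QR -> isotropic QR (limg j) ->
          exists nu : R, forall a b a' b' : gR,
            QR ((psi^-1)%VF (a \ox 1 + b \ox J_real R n))
               ((psi^-1)%VF (a' \ox 1 + b' \ox J_real R n))
            = nu * (killing_form a b' + killing_form b a')].
Proof.
split.
- exact: (double_galois_action g_simple theta_iso phi_iso phi_g sd_action
    sd_fixed sg_action sg_fixed).
- exact: (real_double_iso g_simple theta_iso j_hom phi_iso phi_g sd_action
    sd_fixed sg_action sg_fixed A_eq).
move=> n psi psi_iso psi_j QR Qnd Qinv Qiso.
(* Simplicity of [g] is transported along [theta] to the complexification of [gR]. *)
exact: (quadratic_double_form (simple_lie_iso theta_iso g_simple)
  (A_real_quadratic R n) psi_iso psi_j Qnd Qinv Qiso).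
Qed.
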